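(* Let $G$ be a group acting on a compactly generated Hausdorff path-connected space $X$ with basepoint $x_0$. Let $W$ be a space and let $\Gamma=(\Gamma,\gamma_1,\gamma_2;\nu,\eta)$ be a co-grouplike space with two distinct basepoints. Then the sequence of groups $$1\to\tau^{\Gamma_0}_W(X,x_0)\to\sigma^\Gamma_W(X,x_0,G)\xrightarrow{\ \pi\ }G\to1$$ is exact, where $\pi([f;g])=g$ and the first map sends the class of a pointed map $\Gamma_0\wedge(W\sqcup\{*\})\to X$ to $[f;1]$, with $f$ its composite with the quotient map $\Gamma(W)\to\Gamma(W)/(\bar\gamma_1\sim\bar\gamma_2)\approx\Gamma_0\wedge(W\sqcup\{*\})$.
   Context: $G$ acts on $X$ by homeomorphisms. **Co-grouplike space with two basepoints.** This is a space $\Gamma$ with points $\gamma_1\ne\gamma_2$ and maps $\nu,\eta$ as follows. Put $D=\Gamma\times\{\gamma_1\}\cup\{\gamma_2\}\times\Gamma$. (I) $\nu:(\Gamma,\gamma_1,\gamma_2)\to(D,(\gamma_1,\gamma_1),(\gamma_2,\gamma_2))$ is a map such that, for $i=1,2$, $\mathrm{proj}_i\circ\nu\simeq\mathrm{id}$ as maps of triples $(\Gamma,\gamma_1,\gamma_2)\to(\Gamma,\gamma_1,\gamma_2)$, where $\mathrm{proj}_1,\mathrm{proj}_2:D\to\Gamma$ are the coordinate projections. (II) $\eta:\Gamma\to\Gamma$ is a map such that: - (a) $\eta(\gamma_1)=\gamma_2$ and $\eta(\gamma_2)=\gamma_1$. - (b) Let $h:D\to\Gamma$ be given by $h(\gamma,\gamma_1)=\gamma$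 and $h(\gamma_2,\gamma)=\eta(\gamma)$. Then $h\circ\nu$, which sends both basepoints to $\gamma_1$, is homotopic to the constant map at $\gamma_1$. - (c) Let $h':D\to\Gamma$ be given by $h'(\gamma,\gamma_1)=\eta(\gamma)$ and $h'(\gamma_2,\gamma)=\gamma$. Then $h'\circ\nu$, which sends both basepoints to $\gamma_2$, is homotopic to the constant map at $\gamma_2$. The homotopies in (b) and (c) keep the images of $\gamma_1,\gamma_2$ fixed. (III) (Co-associativity) Let $T=\{(\gamma,\gamma_1,\gamma_1)\}\cup\{(\gamma_2,\gamma,\gamma_1)\}\cup\{(\gamma_2,\gamma_2,\gamma)\}\subset\Gamma^3$ ($\gamma\in\Gamma$), with basepoints $(\gamma_1,\gamma_1,\gamma_1)$ and $(\gamma_2,\gamma_2,\gamma_2)$. The two maps $\Gamma\to T$ obtained from $\nu$ followed respectively by - $(\gamma,\gamma_1)\mapsto(\gamma,\gamma_1,\gamma_1)$, $(\gamma_2,\gamma)\mapsto(\gamma_2,\nu(\gamma))$, and - $(\gamma,\gamma_1)\mapsto(\nu(\gamma),\gamma_1)$, $(\gamma_2,\gamma)\mapsto(\gamma_2,\gamma_2,\gamma)$ are homotopic (as maps preserving the two basepoints). **Associated objects.** $\Gamma_0$ is $\Gamma$ with $\gamma_1$ and $\gamma_2$ identified; the common image is its basepoint, and it is a co-grouplike space in the usual sense, with comultiplication induced by $\nu$. For a space $W$, $\Gamma(W)=(W\times\Gamma)/\big((w,\gamma_1)\sim(w',\gamma_1),\ (w,\gamma_2)\sim(w',\gamma_2)\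 \forall w,w'\in W\big)$. Its basepoints $\bar\gamma_1,\bar\gamma_2$ are the classes of $(w,\gamma_1)$ and $(w,\gamma_2)$. Identifying $\bar\gamma_1$ with $\bar\gamma_2$ gives a space canonically homeomorphic to $\Gamma_0\wedge(W\sqcup\{*\})$, where $W\sqcup\{*\}$ is $W$ with a disjoint basepoint. **Groups.** $\sigma^\Gamma_W(X,x_0,G)=\{[f;g]: g\in G,\ f:(\Gamma(W),\bar\gamma_1,\bar\gamma_2)\to(X,x_0,gx_0)\}$ is the $W$-$\Gamma$-Rhodes group, where $[f;g]$ is the homotopy class of $f$ through maps of triples $(\Gamma(W),\bar\gamma_1,\bar\gamma_2)\to(X,x_0,gx_0)$. The operation is $[f_1;g_1]*[f_2;g_2]=[f_1+g_1f_2;g_1g_2]$. Here $(f_1+g_1f_2)(w,\gamma)=f_1(w,\gamma')$ if $\nu(\gamma)=(\gamma',\gamma_1)$, and $(f_1+g_1f_2)(w,\gamma)=g_1\cdot f_2(w,\gamma'')$ if $\nu(\gamma)=(\gamma_2,\gamma'')$. $\tau^{\Gamma_0}_W(X,x_0)=[\Gamma_0\wedge(W\sqcup\{*\}),X]$ is the $\Gamma_0$-$W$-Fox group (pointed homotopy classes, with group structure from the co-grouplike structure of $\Gamma_0$).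
   Formalization: The two basepoints of Γ are additionally assumed to be closed points (automatic for Hausdorff Γ); without this the claim fails, e.g. for the two-point indiscrete Γ, where π need not be onto. *)

(* Defs.v *)
From HB Require Import structures.
From mathcomp Require Import all_boot all_order all_algebra.
From mathcomp Require Import all_classical all_reals all_analysis.
Import Order.TTheory GRing.Theory Num.Theory numFieldNormedType.Exports.

Set Implicit Arguments.
Unset Strict Implicit.
Unset Printing Implicit Defensive.

Local Open Scope classical_set_scope.
Local Open Scope quotient_scope.
Local Open Scope ring_scope.

(* f and g are homotopic through maps into B, relative to A.  When f and g
   agree on A = {a, b}, this is homotopy through maps of triples
   (Y, a, b) -> (B, f a, f b). *)
Definition homotopic (R : realType) (Y Z : topologicalType)
    (A : set Y) (B : set Z) (f g : Y -> Z) : Prop :=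
  exists H : Y * R -> Z,
    [/\ {within [set: Y] `*` `[0, 1]%classic, continuous H},
        forall y, H (y, 0) = f y,
        forall y, H (y, 1) = g y,
        forall y t, 0 <= t <= 1 -> B (H (y, t)) &
        forall y t, A y -> 0 <= t <= 1 -> H (y, t) = f y].

Definition path_connected_space (R : realType) (X : topologicalType) : Prop :=
  forall x y : X, exists p : R -> X,
    [/\ {within `[0, 1]%classic, continuous p}, p 0 = x & p 1 = y].

Definition compactly_generated_hausdorff (X : topologicalType) : Prop :=
  hausdorff_space X /\
  forall A : set X, (forall K, compact K -> closed (A `&` K)) -> closed A.

(* A discrete group acting by homeomorphisms: the inverse of act g is
   act g^-1, so continuity of every act g is enough. *)
Record top_action (G : groupType) (X : topologicalType) := TopAction {
  act :> G -> X -> X ;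
  act1 : forall x, act 1%g x = x ;
  actM : forall g h x, act (g * h)%g x = act g (act h x) ;
  act_continuous : forall g, continuous (act g) }.

Section cogrouplike.
Variables (Gam : topologicalType) (g1 g2 : Gam).

(* D = Gam x {g1} U {g2} x Gam and T in Gam^3 carry the subspace topology:
   maps into them are maps into the product whose values lie in the set. *)
Definition Dset : set (Gam * Gam) := [set p | p.2 = g1 \/ p.1 = g2].

Definition Tset : set (Gam * Gam * Gam) :=
  [set p | [\/ p.1.2 = g1 /\ p.2 = g1, p.1.1 = g2 /\ p.2 = g1
             | p.1.1 = g2 /\ p.1.2 = g2]].

(* The map on D given by (x, g1) |-> u x and (g2, x) |-> v x; it is only used
   when u g2 = v g1, so the two clauses agree at (g2, g1). *)
Definition on_D (Z : Type) (u v : Gam -> Z) (p : Gam * Gam) : Z :=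
  if p.2 == g1 then u p.1 else v p.2.

(* Closedness of the basepoints is automatic for Hausdorff spaces; it makes
   maps defined piecewise on D continuous.  The indiscrete space with two points
   satisfies all the other fields, but any map from it to a Hausdorff space is
   constant. *)
Record cogroup_axioms (R : realType) (nu : Gam -> Gam * Gam)
    (eta : Gam -> Gam) : Prop := CogroupAxioms {
  cg_closed1 : closed [set g1] ;
  cg_closed2 : closed [set g2] ;
  cg_nu_continuous : continuous nu ;
  cg_nu_D : forall x, Dset (nu x) ;
  cg_nu1 : nu g1 = (g1, g1) ;
  cg_nu2 : nu g2 = (g2, g2) ;
  cg_proj1 : homotopic R [set g1; g2] setT (fst \o nu) id ;
  cg_proj2 : homotopic R [set g1; g2] setT (snd \o nu) id ;
  cg_eta_continuous : continuous eta ;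
  cg_eta1 : eta g1 = g2 ;
  cg_eta2 : eta g2 = g1 ;
  cg_invr : homotopic R [set g1; g2] setT (on_D id eta \o nu) (cst g1) ;
  cg_invl : homotopic R [set g1; g2] setT (on_D eta id \o nu) (cst g2) ;
  cg_coassoc : homotopic R [set g1; g2] Tset
    (on_D (fun x => (x, g1, g1)) (fun x => (g2, (nu x).1, (nu x).2)) \o nu)
    (on_D (fun x => ((nu x).1, (nu x).2, g1)) (fun x => (g2, g2, x)) \o nu) }.

End cogrouplike.

Record cogroup2 (R : realType) := Cogroup2 {
  cg2_space :> topologicalType ;
  cg2_pt1 : cg2_space ;
  cg2_pt2 : cg2_space ;
  cg2_nu : cg2_space -> cg2_space * cg2_space ;
  cg2_eta : cg2_space -> cg2_space ;
  cg2_neq : cg2_pt1 <> cg2_pt2 ;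
  cg2P : cogroup_axioms cg2_pt1 cg2_pt2 R cg2_nu cg2_eta }.

(* The usual notion: when the basepoints coincide, D is the wedge of two copies
   of the space, T the wedge of three, and the axioms are the usual ones. *)
Record cogroup (R : realType) := Cogroup {
  cg_space :> topologicalType ;
  cg_pt : cg_space ;
  cg_nu : cg_space -> cg_space * cg_space ;
  cg_eta : cg_space -> cg_space ;
  cgP : cogroup_axioms cg_pt cg_pt R cg_nu cg_eta }.

Lemma continuous_within_comp (P Q Z : topologicalType) (A : set Q) (f : P -> Q)
    (H : Q -> Z) : continuous f -> (forall p, A (f p)) ->
  {within A, continuous H} -> continuous (H \o f).
Proof.
move=> cf fA /continuousP cH; apply/continuousP => O /cH /open_subspaceP[V oV VE].
rewrite (_ : _ @^-1` O = f @^-1` V); first exact: (continuousP _).1.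
have E p : V (f p) <-> O (H (f p)).
  have [E1 E2] : (V `&` A) (f p) <-> ((H @^-1` O) `&` A) (f p) by rewrite VE.
  by split => h; [have [] := E1 (conj h (fA p))|have [] := E2 (conj h (fA p))].
by apply/seteqP; split => p /=; move/E.
Qed.

Lemma continuous_paste (P Z : topologicalType) (A B : set P) (f u v : P -> Z) :
  closed A -> closed B -> (forall p, A p \/ B p) ->
  continuous u -> continuous v -> (forall p, A p -> f p = u p) ->
  (forall p, B p -> f p = v p) -> continuous f.
Proof.
move=> cA cB AB /continuous_closedP cu /continuous_closedP cv fu fv.
apply/continuous_closedP => C cC.
rewrite (_ : f @^-1` C = (A `&` u @^-1` C) `|` (B `&` v @^-1` C)).
  by apply: closedU; apply: closedI; auto.
apply/seteqP; split => p /=.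
  by case: (AB p) => h; [rewrite fu// | rewrite fv//]; [left|right].
by move=> [[h]|[h]]; [rewrite fu | rewrite fv].
Qed.

Lemma continuous_paste3 (P Z : topologicalType) (A B C : set P)
    (f u v w : P -> Z) :
  closed A -> closed B -> closed C -> (forall p, [\/ A p, B p | C p]) ->
  continuous u -> continuous v -> continuous w -> (forall p, A p -> f p = u p) ->
  (forall p, B p -> f p = v p) -> (forall p, C p -> f p = w p) -> continuous f.
Proof.
move=> cA cB cC ABC /continuous_closedP cu /continuous_closedP cv.
move=> /continuous_closedP cw fu fv fw; apply/continuous_closedP => E cE.
rewrite (_ : f @^-1` E = (A `&` u @^-1` E) `|` (B `&` v @^-1` E)
                           `|` (C `&` w @^-1` E)).
  by apply: closedU; [apply: closedU|]; apply: closedI; auto.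
apply/seteqP; split => p /=.
  by case: (ABC p) => h; [rewrite fu// | rewrite fv// | rewrite fw//];
     [left; left|left; right|right].
by move=> [[[h]|[h]]|[h]]; [rewrite fu | rewrite fv | rewrite fw].
Qed.

Lemma continuous_comp2 (P Q Z : topologicalType) (f : P -> Q) (g : Q -> Z) :
  continuous f -> continuous g -> continuous (fun p => g (f p)).
Proof. by move=> cf cg p; apply: continuous_comp; [exact: cf | exact: cg]. Qed.

Lemma continuous_pair (P Q Z : topologicalType) (f : P -> Q) (g : P -> Z) :
  continuous f -> continuous g -> continuous (fun p => (f p, g p)).
Proof. by move=> cf cg p; apply: cvg_pair; [exact: cf | exact: cg]. Qed.

Lemma continuous_fst (P Q : topologicalType) : continuous (@fst P Q).
Proof. by move=> p; exact: cvg_fst. Qed.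

Lemma continuous_snd (P Q : topologicalType) : continuous (@snd P Q).
Proof. by move=> p; exact: cvg_snd. Qed.

Lemma continuous_idfun (P : topologicalType) : continuous (fun p : P => p).
Proof. by move=> p; exact: cvg_id. Qed.

Lemma continuous_cst (P Q : topologicalType) (q : Q) :
  continuous (fun _ : P => q).
Proof. by move=> p; exact: cvg_cst. Qed.

Lemma closed_fiber (P Q : topologicalType) (f : P -> Q) (q : Q) :
  continuous f -> closed [set q] -> closed [set p | f p = q].
Proof. by move=> /continuous_closedP cf /cf. Qed.

Ltac cont_tac := repeat first
  [ apply: continuous_pair | exact: continuous_idfun | exact: continuous_fst
  | exact: continuous_snd | exact: continuous_cst | assumption
  | apply: (continuous_comp2 _ (@continuous_fst _ _))
  | apply: (continuous_comp2 _ (@continuous_snd _ _))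
  | match goal with
    | h : continuous ?g |- _ => apply: (continuous_comp2 _ h)
    end ].

Definition clamp (R : realType) (t : R) : R := Num.max 0 (Num.min t 1).

Lemma clamp_itv (R : realType) (t : R) : 0 <= clamp t <= 1.
Proof. by rewrite /clamp le_max lexx /= ge_max ler01 ge_min lexx orbT. Qed.

Lemma clamp_continuous (R : realType) : continuous (@clamp R).
Proof.
apply: (@continuous_paste3 _ _ [set t : R | t <= 0]
  [set t | 0 <= t <= 1] [set t | 1 <= t] _ (fun=> 0) id (fun=> 1)).
- exact: closed_le.
- rewrite (_ : mkset _ = [set t : R | 0 <= t] `&` [set t | t <= 1]).
    by apply: closedI; [exact: closed_ge | exact: closed_le].
  by apply/seteqP; split => t /=; [move/andP | move=> ?; apply/andP].
- exact: closed_ge.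
- move=> t /=; case: (leP t 0) => [|/ltW] t0; first by constructor 1.
  by case: (leP t 1) => [|/ltW] t1; [constructor 2; rewrite ?t0 | constructor 3].
- exact: continuous_cst.
- exact: continuous_idfun.
- exact: continuous_cst.
- by move=> t /= t0; rewrite /clamp max_l// ge_min t0.
- by move=> t /= /andP[t0 t1]; rewrite /clamp min_l// max_r.
- by move=> t /= t1; rewrite /clamp min_r// max_r.
Qed.

Lemma clamp_id (R : realType) (t : R) : 0 <= t <= 1 -> clamp t = t.
Proof. by move=> /andP[t0 t1]; rewrite /clamp min_l// max_r. Qed.

Section homotopic_lemmas.
Variables (R : realType) (Y Z : topologicalType).
Implicit Types (A : set Y) (B : set Z) (f g h : Y -> Z).

Lemma homotopicP A B f g : homotopic R A B f g <->
  exists H : Y * R -> Z,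
    [/\ continuous H, forall y, H (y, 0) = f y, forall y, H (y, 1) = g y,
        forall y t, B (H (y, t)) & forall y t, A y -> H (y, t) = f y].
Proof.
split=> -[H [cH H0 H1 HB HA]].
  exists (H \o (fun p => (p.1, clamp p.2))); split => /=.
  - apply: (continuous_within_comp _ _ cH); last first.
      by move=> [y t]; split => //=; rewrite in_itv/=; exact: clamp_itv.
    have cc := @clamp_continuous R; cont_tac.
  - by move=> y; rewrite clamp_id ?lexx ?ler01.
  - by move=> y; rewrite clamp_id ?lexx ?ler01.
  - by move=> y t; apply: HB; exact: clamp_itv.
  - by move=> y t Ay; apply: HA => //; exact: clamp_itv.
exists H; split; auto.
exact: continuous_subspaceT.
Qed.

Lemma homotopic_refl A B f : continuous f -> (forall y, B (f y)) ->
  homotopic R A B f f.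
Proof.
move=> cf Bf; apply/homotopicP; exists (fun p => f p.1); split => //=.
cont_tac.
Qed.

Lemma homotopic_sym A B f g : homotopic R A B f g -> homotopic R A B g f.
Proof.
move=> /homotopicP[H [cH H0 H1 HB HA]]; apply/homotopicP.
exists (fun p => H (p.1, 1 - p.2)); split => //=.
- have cN : continuous (fun t : R => 1 - t).
    by move=> t; apply: cvgB; [exact: cvg_cst | exact: cvg_id].
  cont_tac.
- by move=> y; rewrite subr0.
- by move=> y; rewrite subrr.
- by move=> y t Ay; rewrite HA// -H1 HA.
Qed.

Lemma homotopic_trans A B f g h :
  homotopic R A B f g -> homotopic R A B g h -> homotopic R A B f h.
Proof.
move=> /homotopicP[H [cH H0 H1 HB HA]] /homotopicP[K [cK K0 K1 KB KA]].
have gf y : A y -> g y = f y by move=> Ay; rewrite -H1 HA.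
have half : 2^-1 <= 1 :> R by rewrite invf_le1 ?ler1n.
pose L := fun p : Y * R => if p.2 <= 2^-1 then H (p.1, p.2 * 2)
                           else K (p.1, p.2 * 2 - 1).
apply/homotopicP; exists L; split.
- have c1 : continuous (fun t : R => t * 2).
    by move=> t; apply: cvgM; [exact: cvg_id | exact: cvg_cst].
  have c2 : continuous (fun t : R => t * 2 - 1).
    by move=> t; apply: cvgB; [exact: c1 | exact: cvg_cst].
  apply: (@continuous_paste _ _ [set p : Y * R | p.2 <= 2^-1]
     [set p | 2^-1 <= p.2] _ (fun p => H (p.1, p.2 * 2))
     (fun p => K (p.1, p.2 * 2 - 1))).
  + exact: ((continuous_closedP _).1 (@continuous_snd Y R) _ (@closed_le R 2^-1)).
  + exact: ((continuous_closedP _).1 (@continuous_snd Y R) _ (@closed_ge R 2^-1)).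
  + by move=> p /=; case: (leP p.2 2^-1) => [|/ltW]; [left|right].
  + cont_tac.
  + cont_tac.
  + by move=> p /= hp; rewrite /L hp.
  + move=> p /=; rewrite le_eqVlt => /orP[/eqP hp|hp].
      by rewrite /L -hp lexx mulVf ?pnatr_eq0// subrr H1 K0.
    by rewrite /L leNgt hp.
- by move=> y; rewrite /L/= invr_ge0 ler0n mul0r.
- move=> y; rewrite /L/= ifF ?mul1r; last first.
    by apply/negbTE; rewrite -ltNge invf_lt1 ?ltr1n.
  by rewrite (_ : 2 - 1 = 1 :> R) ?K1//; apply/eqP; rewrite subr_eq.
- by move=> y t; rewrite /L; case: ifP.
- by move=> y t Ay; rewrite /L; case: ifP => _ /=; rewrite ?HA// KA// gf.
Qed.

End homotopic_lemmas.

Section quotient_lemmas.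
Variables (R : realType) (P X : topologicalType) (Q0 : quotType P).
Local Notation Q := (quotient_topology Q0).

Lemma homotopic_quotient (A : set Q) (B : set X) (f g : Q -> X)
    (H : P * R -> X) : continuous H ->
  (forall p p' t, \pi_Q p = \pi_Q p' -> H (p, t) = H (p', t)) ->
  (forall p, H (p, 0) = f (\pi_Q p)) -> (forall p, H (p, 1) = g (\pi_Q p)) ->
  (forall p t, B (H (p, t))) ->
  (forall p t, A (\pi_Q p) -> H (p, t) = f (\pi_Q p)) ->
  homotopic R A B f g.
Proof.
move=> cH Hpi H0 H1 HB HA; apply/homotopicP.
pose F : Q -> {compact-open, R -> X} := fun q t => H (repr q, t).
have Fpi : F \o \pi_Q = curry H.
  by apply/funext => p; apply/funext => t; apply: Hpi; rewrite reprK.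
have cF : continuous F.
  apply/quotient_continuous; rewrite Fpi; exact: continuous_curry_fun.
have cFq q : continuous (F q).
  by move=> t; apply: (continuous_comp2 _ cH); cont_tac.
exists (uncurry F); split.
- apply: (continuous_uncurry _ _ cF cFq); first exact: locally_compactR.
  exact: Rhausdorff.
- by move=> q; rewrite /uncurry/F H0 reprK.
- by move=> q; rewrite /uncurry/F H1 reprK.
- by move=> q t; exact: HB.
- by move=> q t Aq; rewrite /uncurry/F HA reprK.
Qed.

Lemma homotopic_pi (A : set Q) (A' : set P) (B : set X) (f g : Q -> X) :
  (forall p, A' p -> A (\pi_Q p)) ->
  homotopic R A B f g -> homotopic R A' B (f \o \pi_Q) (g \o \pi_Q).
Proof.
move=> AA' /homotopicP[H [cH H0 H1 HB HA]]; apply/homotopicP.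
exists (fun p => H (\pi_Q p.1, p.2)); split => //=.
- have cpi := @pi_continuous P Q0; cont_tac.
- by move=> y t /AA'; exact: HA.
Qed.

End quotient_lemmas.

Section cogroup_addition.
Variables (R : realType) (Gam : topologicalType) (g1 g2 : Gam).
Variables (nu : Gam -> Gam * Gam) (eta : Gam -> Gam).
Hypothesis cg : cogroup_axioms g1 g2 R nu eta.
Variables (Z X : topologicalType).
Implicit Types (F : Z * Gam -> X).

Definition cg_add F1 F2 (p : Z * Gam) : X :=
  on_D g1 (fun x => F1 (p.1, x)) (fun x => F2 (p.1, x)) (nu p.2).

Definition cg_add_base (Z0 : set Z) : set (Z * Gam) :=
  [set p | [\/ p.2 = g1, p.2 = g2 | Z0 p.1]].

Lemma on_DE2 (Y : Type) (u v : Gam -> Y) p : u g2 = v g1 ->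
  p.1 = g2 -> on_D g1 u v p = v p.2.
Proof. by move=> uv p1; rewrite /on_D; case: eqP => // ->; rewrite p1. Qed.

Lemma glue2_continuous (P : topologicalType) (F1 F2 : P * Gam -> X)
    (a b : P -> Gam) : continuous a -> continuous b ->
  (forall p, Dset g1 g2 (a p, b p)) -> continuous F1 -> continuous F2 ->
  (forall p, F1 (p, g2) = F2 (p, g1)) ->
  continuous (fun p => on_D g1 (fun x => F1 (p, x)) (fun x => F2 (p, x)) (a p, b p)).
Proof.
move=> ca cb ab cF1 cF2 F12.
apply: (@continuous_paste _ _ [set p | b p = g1] [set p | a p = g2] _
  (fun p => F1 (p, a p)) (fun p => F2 (p, b p))) => //.
- exact: closed_fiber (cg_closed1 cg).
- exact: closed_fiber (cg_closed2 cg).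
- cont_tac.
- cont_tac.
- by move=> p /= bp; rewrite /on_D /= bp eqxx.
- by move=> p /= ap; rewrite on_DE2.
Qed.

Definition on_T (F1 F2 F3 : Z * Gam -> X) (z : Z) (p : Gam * Gam * Gam) : X :=
  if p.2 == g1 then if p.1.2 == g1 then F1 (z, p.1.1) else F2 (z, p.1.2)
  else F3 (z, p.2).

Lemma glue3_continuous (P : topologicalType) (F1 F2 F3 : Z * Gam -> X)
    (z : P -> Z) (k : P -> Gam * Gam * Gam) : continuous z -> continuous k ->
  (forall p, Tset g1 g2 (k p)) -> continuous F1 -> continuous F2 ->
  continuous F3 ->
  (forall z, F1 (z, g2) = F2 (z, g1)) -> (forall z, F2 (z, g2) = F3 (z, g1)) ->
  continuous (fun p => on_T F1 F2 F3 (z p) (k p)).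
Proof.
move=> cz ck kT cF1 cF2 cF3 F12 F23.
have c1 : continuous (fun p => (k p).1.1) by cont_tac.
have c2 : continuous (fun p => (k p).1.2) by cont_tac.
have c3 : continuous (fun p => (k p).2) by cont_tac.
have K1 := cg_closed1 cg; have K2 := cg_closed2 cg.
apply: (@continuous_paste3 _ _
  ([set p | (k p).1.2 = g1] `&` [set p | (k p).2 = g1])
  ([set p | (k p).1.1 = g2] `&` [set p | (k p).2 = g1])
  ([set p | (k p).1.1 = g2] `&` [set p | (k p).1.2 = g2]) _
  (fun p => F1 (z p, (k p).1.1)) (fun p => F2 (z p, (k p).1.2))
  (fun p => F3 (z p, (k p).2))).
- by apply: closedI; apply: closed_fiber.
- by apply: closedI; apply: closed_fiber.
- by apply: closedI; apply: closed_fiber.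
- by move=> p; exact: kT.
- cont_tac.
- cont_tac.
- cont_tac.
- by move=> p /= [e1 e2]; rewrite /on_T e1 e2 eqxx.
- move=> p /= [e1 e2]; rewrite /on_T e1 e2 eqxx.
  by case: eqP => // ->.
- move=> p /= [e1 e2]; rewrite /on_T e1 e2; case: eqP => // ->.
  by case: eqP => [e|_]; [rewrite F12 -{1}e F23 | rewrite F23].
Qed.

Lemma cg_addE1 F1 F2 z : F1 (z, g2) = F2 (z, g1) ->
  cg_add F1 F2 (z, g1) = F1 (z, g1).
Proof. by move=> _; rewrite /cg_add /= (cg_nu1 cg) /on_D /= eqxx. Qed.

Lemma cg_addE2 F1 F2 z : F1 (z, g2) = F2 (z, g1) ->
  cg_add F1 F2 (z, g2) = F2 (z, g2).
Proof. by move=> F12; rewrite /cg_add /= (cg_nu2 cg) on_DE2. Qed.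

Lemma cg_add_continuous F1 F2 : continuous F1 -> continuous F2 ->
  (forall z, F1 (z, g2) = F2 (z, g1)) -> continuous (cg_add F1 F2).
Proof.
move=> cF1 cF2 F12; have cnu := cg_nu_continuous cg.
have := @glue2_continuous (Z * Gam)%type (fun q => F1 (q.1.1, q.2))
  (fun q => F2 (q.1.1, q.2)) (fun p => (nu p.2).1) (fun p => (nu p.2).2).
rewrite [X in _ -> _ -> _ -> _ -> _ -> _ -> continuous X](_ : _ = cg_add F1 F2).
  apply; rewrite //=; try cont_tac.
  by move=> p; rewrite -surjective_pairing; exact: cg_nu_D cg _.
by apply/funext => p; rewrite /cg_add -surjective_pairing.
Qed.

Lemma cg_add_const F1 F2 z c : (forall x, F1 (z, x) = c) ->
  (forall x, F2 (z, x) = c) -> forall x, cg_add F1 F2 (z, x) = c.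
Proof. by move=> e1 e2 x; rewrite /cg_add /on_D /=; case: ifP. Qed.

Section rel.
Variable Z0 : set Z.
Local Notation "F ~ G" := (homotopic R (cg_add_base Z0) setT F G)
  (at level 70, no associativity).
Implicit Type c : Z -> X.

Lemma cg_add_cong F1 F2 F1' F2' : (forall z, F1 (z, g2) = F2 (z, g1)) ->
  F1 ~ F1' -> F2 ~ F2' -> cg_add F1 F2 ~ cg_add F1' F2'.
Proof.
move=> F12 /homotopicP[H [cH H0 H1 _ HA]] /homotopicP[K [cK K0 K1 _ KA]].
have cnu := cg_nu_continuous cg; apply/homotopicP.
exists (fun p => on_D g1 (fun x => H ((p.1.1, x), p.2))
                         (fun x => K ((p.1.1, x), p.2)) (nu p.1.2)); split.
- have := @glue2_continuous ((Z * Gam) * R)%type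
    (fun q => H ((q.1.1.1, q.2), q.1.2)) (fun q => K ((q.1.1.1, q.2), q.1.2))
    (fun p => (nu p.1.2).1) (fun p => (nu p.1.2).2).
  under [X in _ -> _ -> _ -> _ -> _ -> _ -> continuous X]eq_fun
    do rewrite -surjective_pairing.
  apply; rewrite //=; try cont_tac.
    by move=> p; rewrite -surjective_pairing; exact: cg_nu_D cg _.
  move=> p; rewrite HA ?KA//; first by constructor 1.
  by constructor 2.
- by move=> p; rewrite /cg_add /on_D /=; case: ifP.
- by move=> p; rewrite /cg_add /on_D /=; case: ifP.
- by [].
- move=> [z x] t /= [/= ->|/= ->|/= z0].
  + by rewrite cg_addE1// (cg_nu1 cg) /on_D /= eqxx HA//; constructor 1.
  + have e : H ((z, g2), t) = K ((z, g1), t).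
      by rewrite HA ?KA//; [constructor 1 | constructor 2].
    by rewrite cg_addE2// (cg_nu2 cg) on_DE2//= KA//; constructor 2.
  + by rewrite /cg_add /on_D /=; case: ifP => _; rewrite ?HA ?KA//; constructor 3.
Qed.

Definition const_on F := forall z x y, Z0 z -> F (z, x) = F (z, y).

Lemma cg_precomp F (k k' : Gam -> Gam) : continuous F -> const_on F ->
  homotopic R [set g1; g2] setT k k' ->
  (fun p => F (p.1, k p.2)) ~ (fun p => F (p.1, k' p.2)).
Proof.
move=> cF F0 /homotopicP[K [cK K0 K1 _ KA]]; apply/homotopicP.
exists (fun p => F (p.1.1, K (p.1.2, p.2))); split => //=.
- cont_tac.
- by move=> p; rewrite K0.
- by move=> p; rewrite K1.
- move=> [z x] t /= [/= ->|/= ->|/= z0].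
  + by rewrite KA//; left.
  + by rewrite KA//; right.
  + exact: F0.
Qed.

Lemma cg_addA F1 F2 F3 : continuous F1 -> continuous F2 -> continuous F3 ->
  const_on F1 -> const_on F2 -> const_on F3 ->
  (forall z, F1 (z, g2) = F2 (z, g1)) -> (forall z, F2 (z, g2) = F3 (z, g1)) ->
  cg_add F1 (cg_add F2 F3) ~ cg_add (cg_add F1 F2) F3.
Proof.
move=> cF1 cF2 cF3 z1 z2 z3 F12 F23.
have /homotopicP[K [cK K0 K1 KT KA]] := cg_coassoc cg.
have KE0 z x : on_T F1 F2 F3 z (K (x, 0)) = cg_add F1 (cg_add F2 F3) (z, x).
  rewrite K0 /cg_add /on_T /on_D /=; case: (nu x) => a b /=.
  case: (b == g1) => /=; first by rewrite !eqxx.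
  by case: (nu b) => a' b' /=; case: eqP => // _; case: eqP => // ->.
have KE1 z x : on_T F1 F2 F3 z (K (x, 1)) = cg_add (cg_add F1 F2) F3 (z, x).
  rewrite K1 /cg_add /on_T /on_D /=; case: (nu x) => a b /=.
  by case E : (b == g1) => /=; rewrite ?eqxx ?E.
apply/homotopicP; exists (fun p => on_T F1 F2 F3 p.1.1 (K (p.1.2, p.2))); split.
- by apply: glue3_continuous => //; cont_tac.
- by move=> [z x] /=; rewrite KE0.
- by move=> [z x] /=; rewrite KE1.
- by [].
- move=> [z x] t /= [/= ->|/= ->|/= z0].
  + by rewrite -KE0 !KA//; left.
  + by rewrite -KE0 !KA//; right.
  + rewrite /on_T /cg_add /on_D /=.
    have e1 y : F1 (z, y) = F1 (z, g1) by exact: z1.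
    have e2 y : F2 (z, y) = F1 (z, g1).
      by rewrite (z2 z y g1)// -F12 e1.
    have e3 y : F3 (z, y) = F1 (z, g1).
      by rewrite (z3 z y g1)// -F23 e2.
    by rewrite !e1 !e2 !e3 !if_same.
Qed.

Lemma cg_add1r F c : continuous F -> const_on F ->
  (forall z, F (z, g2) = c z) -> cg_add F (fun p => c p.1) ~ F.
Proof.
move=> cF F0 Fc.
rewrite (_ : cg_add _ _ = fun p => F (p.1, (fst \o nu) p.2)).
  rewrite [X in _ ~ X](_ : F = fun p => F (p.1, id p.2)).
    exact: cg_precomp (cg_proj1 cg).
  by apply/funext => -[].
apply/funext => -[z x]; rewrite /cg_add /on_D /=; case: eqP => // ne.
by case: (cg_nu_D cg x) => // ->; rewrite Fc.
Qed.

Lemma cg_add1l F c : continuous F -> const_on F ->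
  (forall z, F (z, g1) = c z) -> cg_add (fun p => c p.1) F ~ F.
Proof.
move=> cF F0 Fc.
rewrite (_ : cg_add _ _ = fun p => F (p.1, (snd \o nu) p.2)).
  rewrite [X in _ ~ X](_ : F = fun p => F (p.1, id p.2)).
    exact: cg_precomp (cg_proj2 cg).
  by apply/funext => -[].
apply/funext => -[z x]; rewrite /cg_add /on_D /=; case: eqP => // ->.
by rewrite Fc.
Qed.

Lemma cg_addNr F : continuous F -> const_on F ->
  cg_add F (fun p => F (p.1, eta p.2)) ~ (fun p => F (p.1, g1)).
Proof.
move=> cF F0.
rewrite (_ : cg_add _ _ = fun p => F (p.1, (on_D g1 id eta \o nu) p.2)).
  exact: cg_precomp (cg_invr cg).
by apply/funext => -[z x]; rewrite /cg_add /on_D /=; case: ifP.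
Qed.

Lemma cg_addNl F : continuous F -> const_on F ->
  cg_add (fun p => F (p.1, eta p.2)) F ~ (fun p => F (p.1, g2)).
Proof.
move=> cF F0.
rewrite (_ : cg_add _ _ = fun p => F (p.1, (on_D g1 eta id \o nu) p.2)).
  exact: cg_precomp (cg_invl cg).
by apply/funext => -[z x]; rewrite /cg_add /on_D /=; case: ifP.
Qed.

Lemma cg_add_opp F F' : F ~ F' ->
  (fun p => F (p.1, eta p.2)) ~ (fun p => F' (p.1, eta p.2)).
Proof.
move=> /homotopicP[H [cH H0 H1 _ HA]]; have ceta := cg_eta_continuous cg.
apply/homotopicP; exists (fun p => H ((p.1.1, eta p.1.2), p.2)); split => //=.
- cont_tac.
- move=> [z x] t /= h; apply: HA; case: h => /= [->|->|h].
  + by constructor 2; rewrite (cg_eta1 cg).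
  + by constructor 1; rewrite (cg_eta2 cg).
  + by constructor 3.
Qed.

End rel.
End cogroup_addition.

(* Y with the subset A collapsed to a point. *)
Section collapse.
Variables (Y : topologicalType) (A : set Y).

Definition collapse_rel (x y : Y) : bool := (x == y) || `[< A x /\ A y >].

Lemma collapse_rel_refl : reflexive collapse_rel.
Proof. by move=> x; rewrite /collapse_rel eqxx. Qed.

Lemma collapse_rel_sym : symmetric collapse_rel.
Proof.
by move=> x y; rewrite /collapse_rel eq_sym; congr (_ || _);
  apply/asboolP/asboolP => -[].
Qed.

Lemma collapse_rel_trans : transitive collapse_rel.
Proof.
move=> y x z; rewrite /collapse_rel => /orP[/eqP->//|/asboolP[Ax Ay]].
move=> /orP[/eqP<-|/asboolP[_ Az]]; apply/orP; right; exact/asboolP.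
Qed.

Definition collapse_equiv :=
  EquivRel collapse_rel collapse_rel_refl collapse_rel_sym collapse_rel_trans.

Definition collapse := {eq_quot collapse_equiv}.

HB.instance Definition _ := Topological.copy collapse (quotient_topology collapse).
HB.instance Definition _ := Quotient.on collapse.

Lemma collapseP (x y : Y) :
  \pi_collapse x = \pi_collapse y <-> x = y \/ A x /\ A y.
Proof.
split=> [/eqmodP/orP[/eqP|/asboolP]|[->//|Axy]]; [by left|by right|].
by apply/eqmodP/orP; right; exact/asboolP.
Qed.

End collapse.

(* W with a disjoint basepoint None. *)
Definition add_point (W : Type) : Type := option W.

Section add_point_topology.
Variable W : topologicalType.
HB.instance Definition _ := Choice.copy (add_point W) (option W).

Definition add_point_open (U : set (add_point W)) := open (@Some W @^-1` U).

Lemma add_point_openT : add_point_open setT.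
Proof. exact: openT. Qed.

Lemma add_point_openI : setI_closed add_point_open.
Proof. by move=> U V; exact: openI. Qed.

Lemma add_point_open_bigU (I : Type) (f : I -> set (add_point W)) :
  (forall i, add_point_open (f i)) -> add_point_open (\bigcup_i f i).
Proof. by move=> of_; apply: bigcup_open => i _; exact: of_. Qed.

HB.instance Definition _ := isOpenTopological.Build (add_point W)
  add_point_openT add_point_openI add_point_open_bigU.

Lemma Some_continuous : continuous (Some : W -> add_point W).
Proof. exact/continuousP. Qed.

End add_point_topology.

Definition smash (Y : topologicalType) (y0 : Y) (Z : topologicalType) (z0 : Z) :=
  collapse [set p : Y * Z | p.1 = y0 \/ p.2 = z0].

(* Gam with its two basepoints identified is co-grouplike in the usual sense. *)
Section cogroup0.
Variables (R : realType) (Gam : cogroup2 R).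
Let g1 := cg2_pt1 Gam.
Let g2 := cg2_pt2 Gam.
Let nu := @cg2_nu R Gam.
Let eta := @cg2_eta R Gam.
Let cg : cogroup_axioms g1 g2 R nu eta := cg2P Gam.
Let cnu := cg_nu_continuous cg.
Let ceta := cg_eta_continuous cg.

Definition Gam0 := collapse [set g1; g2].
Local Notation pi0 := (\pi_Gam0).

Definition Gam0_pt : Gam0 := pi0 g1.

Definition Gam0_nu (q : Gam0) : Gam0 * Gam0 :=
  (pi0 (nu (repr q)).1, pi0 (nu (repr q)).2).

Definition Gam0_eta (q : Gam0) : Gam0 := pi0 (eta (repr q)).

Arguments Gam0_nu : simpl never.
Arguments Gam0_eta : simpl never.

Lemma Gam0P x y : pi0 x = pi0 y <->
  x = y \/ [set g1; g2] x /\ [set g1; g2] y.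
Proof. exact: collapseP. Qed.

Lemma pi0_g2 : pi0 g2 = Gam0_pt.
Proof. by apply/Gam0P; right; split; [right|left]. Qed.

Lemma Gam0_nuE x : Gam0_nu (pi0 x) = (pi0 (nu x).1, pi0 (nu x).2).
Proof.
rewrite /Gam0_nu; have /Gam0P[->//|[]] : pi0 (repr (pi0 x)) = pi0 x by rewrite reprK.
by move=> [->|->] [->|->]; rewrite ?(cg_nu1 cg) ?(cg_nu2 cg) /= ?pi0_g2.
Qed.

Lemma Gam0_etaE x : Gam0_eta (pi0 x) = pi0 (eta x).
Proof.
rewrite /Gam0_eta; have /Gam0P[->//|[]] : pi0 (repr (pi0 x)) = pi0 x by rewrite reprK.
by move=> [->|->] [->|->]; rewrite ?(cg_eta1 cg) ?(cg_eta2 cg) /= ?pi0_g2.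
Qed.

Lemma pi0_continuous : continuous (pi0 : Gam -> Gam0).
Proof. exact: pi_continuous. Qed.
Let cpi := pi0_continuous.

Lemma Gam0_homotopic (Z Z' : topologicalType) (B : set Z) (B' : set Z')
    (f g : Gam -> Z) (f' g' : Gam0 -> Z') (k : Z -> Z') :
  continuous k -> homotopic R [set g1; g2] B f g ->
  (forall x, f' (pi0 x) = k (f x)) -> (forall x, g' (pi0 x) = k (g x)) ->
  (forall z, B z -> B' (k z)) ->
  homotopic R [set Gam0_pt; Gam0_pt] B' f' g'.
Proof.
move=> ck /homotopicP[H [cH H0 H1 HB HA]] ff gg BB.
apply: (@homotopic_quotient R Gam Z' Gam0 _ _ f' g' (fun p => k (H p))).
- cont_tac.
- move=> x y t /Gam0P[->//|[hx hy]]; rewrite !HA// -!ff; congr f'.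
  by apply/Gam0P; right.
- by move=> x; rewrite H0 ff.
- by move=> x; rewrite H1 gg.
- by move=> x t; apply: BB.
- move=> x t hx; rewrite HA ?ff//.
  have /Gam0P[->|[]//] : pi0 x = pi0 g1 by case: hx.
  by left.
Qed.

Lemma Gam0_on_D (Z Z' : Type) (u v : Gam -> Z) (k : Z -> Z')
    (u' v' : Gam0 -> Z') (x : Gam) : u g2 = v g1 ->
  (forall x, u' (pi0 x) = k (u x)) -> (forall x, v' (pi0 x) = k (v x)) ->
  on_D Gam0_pt u' v' (Gam0_nu (pi0 x)) = k (on_D g1 u v (nu x)).
Proof.
move=> uv uu vv; rewrite Gam0_nuE /on_D /=.
have [->|b1] := eqVneq (nu x).2 g1; first by rewrite eqxx uu.
case: eqP => [/Gam0P[e|[b12 _]]|_]; last exact: vv.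
  by rewrite e eqxx in b1.
have b2 : (nu x).2 = g2 by case: b12 => // /eqP; rewrite (negbTE b1).
case: (cg_nu_D cg x) => [e|e]; first by rewrite e eqxx in b1.
have upt : u' Gam0_pt = v' Gam0_pt by rewrite -{1}pi0_g2 uu uv -vv.
by rewrite e b2 pi0_g2 upt -vv pi0_g2.
Qed.

Lemma Gam0_axioms : cogroup_axioms Gam0_pt Gam0_pt R Gam0_nu Gam0_eta.
Proof.
have clpt : closed [set Gam0_pt].
  rewrite -openC.
  suff : open (~` [set g1; g2]).
    congr open; apply/seteqP; split => x /=; apply: contra_not.
      by move=> /Gam0P[->|[]//]; left.
    by case=> ->; rewrite ?pi0_g2.
  by rewrite openC; apply: closedU; [exact: cg_closed1 cg|exact: cg_closed2 cg].
have nupt : Gam0_nu Gam0_pt = (Gam0_pt, Gam0_pt).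
  by rewrite /Gam0_pt Gam0_nuE (cg_nu1 cg).
have etapt : Gam0_eta Gam0_pt = Gam0_pt.
  by rewrite /Gam0_pt Gam0_etaE (cg_eta1 cg) pi0_g2.
have piE (q : Gam0) : exists x, q = pi0 x by exists (repr q); rewrite reprK.
split=> //.
- apply/(@quotient_continuous Gam Gam0).
  rewrite (_ : _ \o _ = fun x => (pi0 (nu x).1, pi0 (nu x).2)).
    cont_tac.
  by apply/funext => x /=; rewrite Gam0_nuE.
- move=> q; have [x ->] := piE q; rewrite Gam0_nuE.
  by case: (cg_nu_D cg x) => /= ->; [left|right; rewrite pi0_g2].
- apply: (Gam0_homotopic cpi (cg_proj1 cg)) => // x.
  exact: (congr1 fst (Gam0_nuE x)).
- apply: (Gam0_homotopic cpi (cg_proj2 cg)) => // x.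
  exact: (congr1 snd (Gam0_nuE x)).
- apply/(@quotient_continuous Gam Gam0).
  rewrite (_ : _ \o _ = fun x => pi0 (eta x)); first cont_tac.
  by apply/funext => x /=; rewrite Gam0_etaE.
- apply: (Gam0_homotopic cpi (cg_invr cg)) => //= x.
  apply: Gam0_on_D => //; first by rewrite (cg_eta1 cg).
  exact: Gam0_etaE.
- apply: (Gam0_homotopic cpi (cg_invl cg)) => //= x; last by rewrite pi0_g2.
  apply: Gam0_on_D => //; first by rewrite (cg_eta2 cg).
  exact: Gam0_etaE.
- have ck : continuous (fun p : Gam * Gam * Gam => (pi0 p.1.1, pi0 p.1.2, pi0 p.2)).
    cont_tac.
  apply: (Gam0_homotopic ck (cg_coassoc cg)).
  + move=> x; rewrite /comp.
    apply: (Gam0_on_D (k := fun p => (pi0 p.1.1, pi0 p.1.2, pi0 p.2))).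
    * by rewrite (cg_nu1 cg).
    * by [].
    * by move=> y; cbv beta; rewrite Gam0_nuE pi0_g2.
  + move=> x; rewrite /comp.
    apply: (Gam0_on_D (k := fun p => (pi0 p.1.1, pi0 p.1.2, pi0 p.2))).
    * by rewrite (cg_nu2 cg).
    * by move=> y; cbv beta; rewrite Gam0_nuE.
    * by move=> y /=; rewrite pi0_g2.
  + by move=> p [[/= -> ->]|[/= -> ->]|[/= -> ->]]; rewrite ?pi0_g2;
      [constructor 1|constructor 2|constructor 3].
Qed.

Definition cogroup0 : cogroup R := Cogroup Gam0_axioms.

End cogroup0.

(* Gam(W): W x Gam with W x {g1} and W x {g2} each collapsed to a point. *)
Section GamW.
Variables (R : realType) (Gam : cogroup2 R) (W : topologicalType).
Let g1 := cg2_pt1 Gam.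
Let g2 := cg2_pt2 Gam.

Definition GamW_rel (p q : W * Gam) : bool :=
  (p.2 == q.2) && [|| p.1 == q.1, p.2 == g1 | p.2 == g2].

Lemma GamW_rel_refl : reflexive GamW_rel.
Proof. by move=> p; rewrite /GamW_rel !eqxx. Qed.

Lemma GamW_rel_sym : symmetric GamW_rel.
Proof.
move=> p q; rewrite /GamW_rel eq_sym (eq_sym p.1).
by have [->|//] := eqVneq q.2 p.2.
Qed.

Lemma GamW_rel_trans : transitive GamW_rel.
Proof.
move=> q p r; rewrite /GamW_rel => /andP[/eqP-> h] /andP[/eqP<- k].
rewrite eqxx /=; case/orP: h => [/eqP->//|->]; exact: orbT.
Qed.

Definition GamW_equiv :=
  EquivRel GamW_rel GamW_rel_refl GamW_rel_sym GamW_rel_trans.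

Definition GamW := {eq_quot GamW_equiv}.

HB.instance Definition _ := Topological.copy GamW (quotient_topology GamW).
HB.instance Definition _ := Quotient.on GamW.

(* The basepoint of Gam(W) coming from g1 (resp. g2), as a singleton; it is
   the empty set when W is empty, which places no condition on maps. *)
Definition GamW_base1 : set GamW := [set \pi_GamW (w, g1) | w in [set: W]].
Definition GamW_base2 : set GamW := [set \pi_GamW (w, g2) | w in [set: W]].

Lemma GamWP (p q : W * Gam) : \pi_GamW p = \pi_GamW q <->
  p = q \/ p.2 = q.2 /\ [set g1; g2] p.2.
Proof.
case: p q => [w x] [w' y]; split=> [/eqmodP/andP[/eqP/= <-]|].
  by case/or3P => /eqP/= ->; [left|right; split => //; left|
    right; split => //; right].
move=> [->//|[/= <- h]]; apply/eqmodP; rewrite /= /GamW_rel /= eqxx /=.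
by case: h => ->; rewrite eqxx ?orbT.
Qed.

Lemma GamW_base1P p : GamW_base1 (\pi_GamW p) <-> p.2 = g1.
Proof.
split=> [[w _ /GamWP[<-//|[/= <-//]]]|].
by case: p => w x /= ->; exists w.
Qed.

Lemma GamW_base2P p : GamW_base2 (\pi_GamW p) <-> p.2 = g2.
Proof.
split=> [[w _ /GamWP[<-//|[/= <-//]]]|].
by case: p => w x /= ->; exists w.
Qed.

End GamW.

Section rhodes.
Variables (R : realType) (G : groupType) (X : topologicalType).
Variables (a : top_action G X) (x0 : X) (Gam : cogroup2 R) (W : topologicalType).
Let g1 := cg2_pt1 Gam.
Let g2 := cg2_pt2 Gam.
Let nu := @cg2_nu R Gam.
Let eta := @cg2_eta R Gam.
Let cg : cogroup_axioms g1 g2 R nu eta := cg2P Gam.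
Local Notation GW := (GamW Gam W).
Local Notation piW := (\pi_GW).

(* Pairs (f, g) with f : (Gam(W), base1, base2) -> (X, x0, g x0). *)
Record rhodes_map := RhodesMap {
  rhodes_fun :> GW -> X ;
  rhodes_elt : G ;
  rhodes_continuous : continuous rhodes_fun ;
  rhodes_base1 : forall q, GamW_base1 q -> rhodes_fun q = x0 ;
  rhodes_base2 : forall q, GamW_base2 q -> rhodes_fun q = a rhodes_elt x0 }.

HB.instance Definition _ := gen_eqMixin rhodes_map.
HB.instance Definition _ := gen_choiceMixin rhodes_map.

Definition rhodes_rel (f1 f2 : rhodes_map) : bool :=
  `[< rhodes_elt f1 = rhodes_elt f2 /\
      homotopic R (@GamW_base1 R Gam W `|` @GamW_base2 R Gam W) setT f1 f2 >].

Lemma rhodes_rel_refl : reflexive rhodes_rel.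
Proof.
move=> f; apply/asboolP; split => //.
by apply: homotopic_refl => //; exact: rhodes_continuous.
Qed.

Lemma rhodes_rel_sym : symmetric rhodes_rel.
Proof.
by move=> f f'; apply/asboolP/asboolP => -[e h]; split; rewrite ?e//;
  exact: homotopic_sym.
Qed.

Lemma rhodes_rel_trans : transitive rhodes_rel.
Proof.
move=> f' f f'' /asboolP[e h] /asboolP[e' h']; apply/asboolP; split; first by rewrite e.
exact: homotopic_trans h h'.
Qed.

Definition rhodes_equiv :=
  EquivRel rhodes_rel rhodes_rel_refl rhodes_rel_sym rhodes_rel_trans.

Definition rhodes := {eq_quot rhodes_equiv}.

HB.instance Definition _ := Quotient.on rhodes.
HB.instance Definition _ := Choice.on rhodes.

Definition rhodes_class (f : rhodes_map) : rhodes := \pi_rhodes f.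

Lemma rhodes_classP f f' : rhodes_class f = rhodes_class f' <->
  rhodes_elt f = rhodes_elt f' /\
  homotopic R (@GamW_base1 R Gam W `|` @GamW_base2 R Gam W) setT f f'.
Proof.
split=> [/eqmodP|h]; first exact: asboolP.
by apply/eqmodP/asboolP.
Qed.

(* Maps out of Gam(W) as maps out of W x Gam. *)
Let low (f : GW -> X) : W * Gam -> X := f \o piW.
Let base := cg_add_base g1 g2 (@set0 W).

Lemma rhodes_low_continuous (f : rhodes_map) : continuous (low f).
Proof. by apply/(@quotient_continuous _ GW); exact: rhodes_continuous. Qed.

Lemma rhodes_low1 (f : rhodes_map) w : low f (w, g1) = x0.
Proof. by apply: rhodes_base1; apply/GamW_base1P. Qed.

Lemma rhodes_low2 (f : rhodes_map) w : low f (w, g2) = a (rhodes_elt f) x0.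
Proof. by apply: rhodes_base2; apply/GamW_base2P. Qed.

Definition GamW_lift (F : W * Gam -> X) (q : GW) : X := F (repr q).

Lemma GamW_liftE (F : W * Gam -> X) p :
  (forall w w', F (w, g1) = F (w', g1)) ->
  (forall w w', F (w, g2) = F (w', g2)) -> GamW_lift F (piW p) = F p.
Proof.
move=> F1 F2; rewrite /GamW_lift.
have /GamWP[->//|[]] : piW (repr (piW p)) = piW p by rewrite reprK.
case: (repr _) => w x; case: p => w' y /= <- [->|->]; [exact: F1|exact: F2].
Qed.

Section mk.
Variables (F : W * Gam -> X) (g : G).
Hypothesis cF : continuous F.
Hypothesis F1 : forall w, F (w, g1) = x0.
Hypothesis F2 : forall w, F (w, g2) = a g x0.

Lemma rhodes_mkE p : GamW_lift F (piW p) = F p.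
Proof. by apply: GamW_liftE => w w'; rewrite ?F1 ?F2. Qed.

Lemma rhodes_mk_continuous : continuous (GamW_lift F).
Proof.
apply/(@quotient_continuous _ GW).
by rewrite (_ : _ \o _ = F)//; apply/funext => p; exact: rhodes_mkE.
Qed.

Lemma rhodes_mk1 q : GamW_base1 q -> GamW_lift F q = x0.
Proof. by move=> [w _ <-]; rewrite rhodes_mkE F1. Qed.

Lemma rhodes_mk2 q : GamW_base2 q -> GamW_lift F q = a g x0.
Proof. by move=> [w _ <-]; rewrite rhodes_mkE F2. Qed.

Definition rhodes_mk : rhodes_map :=
  RhodesMap rhodes_mk_continuous rhodes_mk1 rhodes_mk2.

End mk.

Lemma rhodes_class_low (f f' : rhodes_map) :
  rhodes_class f = rhodes_class f' <->
  rhodes_elt f = rhodes_elt f' /\ homotopic R base setT (low f) (low f').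
Proof.
rewrite rhodes_classP; split=> -[e h]; split => //.
  apply: homotopic_pi h => p [/= h|/= h|//].
    by left; apply/GamW_base1P.
  by right; apply/GamW_base2P.
move/homotopicP: h => [H [cH H0 H1 _ HA]].
have HA1 w t : H ((w, g1), t) = x0.
  by rewrite HA; [exact: rhodes_low1|constructor 1].
have HA2 w t : H ((w, g2), t) = a (rhodes_elt f) x0.
  by rewrite HA; [exact: rhodes_low2|constructor 2].
apply: (@homotopic_quotient R _ X GW _ _ f f' H) => //.
- move=> [w x] [w' y] t /GamWP[->//|[/= <- [|]->]]; by rewrite ?HA1 ?HA2.
- move=> p t h; apply: HA; case: h => h; [constructor 1|constructor 2].
    by apply/GamW_base1P.
  by apply/GamW_base2P.
Qed.

(* f1 + g1 f2: the value at (w, x) is f1 (w, x') if nu x = (x', g1) and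
   g1 f2 (w, x'') if nu x = (g2, x''). *)
Definition rhodes_add (f1 f2 : rhodes_map) (p : W * Gam) : X :=
  on_D g1 (fun x => f1 (piW (p.1, x)))
          (fun x => a (rhodes_elt f1) (f2 (piW (p.1, x)))) (nu p.2).

Let shift (g : G) (F : W * Gam -> X) : W * Gam -> X := a g \o F.

Lemma rhodes_shift_continuous g F : continuous F -> continuous (shift g F).
Proof. by move=> cF p; apply: continuous_comp; [exact: cF|exact: act_continuous]. Qed.

Lemma rhodes_addE f1 f2 :
  rhodes_add f1 f2 = cg_add g1 nu (low f1) (shift (rhodes_elt f1) (low f2)).
Proof. by []. Qed.

Lemma rhodes_matched (f1 f2 : rhodes_map) w :
  low f1 (w, g2) = shift (rhodes_elt f1) (low f2) (w, g1).
Proof. by rewrite rhodes_low2 /shift /= rhodes_low1. Qed.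

Lemma rhodes_add_continuous f1 f2 : continuous (rhodes_add f1 f2).
Proof.
rewrite rhodes_addE; apply: (cg_add_continuous cg).
- exact: rhodes_low_continuous.
- by apply: rhodes_shift_continuous; exact: rhodes_low_continuous.
- by move=> w; exact: rhodes_matched.
Qed.

Lemma rhodes_add1 f1 f2 w : rhodes_add f1 f2 (w, g1) = x0.
Proof.
by rewrite rhodes_addE (cg_addE1 cg) ?rhodes_low1//; exact: rhodes_matched.
Qed.

Lemma rhodes_add2 f1 f2 w :
  rhodes_add f1 f2 (w, g2) = a (rhodes_elt f1 * rhodes_elt f2)%g x0.
Proof.
rewrite rhodes_addE (cg_addE2 cg); last exact: rhodes_matched.
by rewrite /shift /= rhodes_low2 actM.
Qed.

Definition rhodes_map_mul (f1 f2 : rhodes_map) : rhodes_map :=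
  rhodes_mk (@rhodes_add_continuous f1 f2) (rhodes_add1 f1 f2)
            (rhodes_add2 f1 f2).

Lemma rhodes_one1 (w : W) : (fun _ : W * Gam => x0) (w, g1) = x0.
Proof. by []. Qed.

Lemma rhodes_one2 (w : W) : (fun _ : W * Gam => x0) (w, g2) = a 1%g x0.
Proof. by rewrite act1. Qed.

Definition rhodes_map_one : rhodes_map :=
  rhodes_mk (@continuous_cst _ _ x0) rhodes_one1 rhodes_one2.

Definition rhodes_opp (f : rhodes_map) (p : W * Gam) : X :=
  a (rhodes_elt f)^-1%g (f (piW (p.1, eta p.2))).

Lemma rhodes_opp_continuous f : continuous (rhodes_opp f).
Proof.
have ceta := cg_eta_continuous cg; have cf := @rhodes_low_continuous f.
have cF : continuous (fun p : W * Gam => low f (p.1, eta p.2)) by cont_tac.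
by move=> p; apply: (continuous_comp (cF p)); exact: act_continuous.
Qed.

Lemma rhodes_opp1 f w : rhodes_opp f (w, g1) = x0.
Proof.
rewrite /rhodes_opp /= (cg_eta1 cg) [f _](rhodes_low2 f w).
by rewrite -actM mulVg act1.
Qed.

Lemma rhodes_opp2 f w : rhodes_opp f (w, g2) = a (rhodes_elt f)^-1%g x0.
Proof. by rewrite /rhodes_opp /= (cg_eta2 cg) [f _](rhodes_low1 f w). Qed.

Definition rhodes_map_inv (f : rhodes_map) : rhodes_map :=
  rhodes_mk (@rhodes_opp_continuous f) (rhodes_opp1 f) (rhodes_opp2 f).

Lemma rhodes_low_mul f1 f2 : low (rhodes_map_mul f1 f2) = rhodes_add f1 f2.
Proof.
apply/funext => p; apply: rhodes_mkE; [exact: rhodes_add1|exact: rhodes_add2].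
Qed.

Lemma rhodes_low_one : low rhodes_map_one = fun=> x0.
Proof.
apply/funext => p; apply: rhodes_mkE; [exact: rhodes_one1|exact: rhodes_one2].
Qed.

Lemma rhodes_low_inv f : low (rhodes_map_inv f) = rhodes_opp f.
Proof.
apply/funext => p; apply: rhodes_mkE; [exact: rhodes_opp1|exact: rhodes_opp2].
Qed.

Lemma rhodes_shift_homotopic g F F' : homotopic R base setT F F' ->
  homotopic R base setT (shift g F) (shift g F').
Proof.
move=> /homotopicP[H [cH H0 H1 _ HA]]; apply/homotopicP.
have cg' : continuous (a g) by exact: act_continuous.
exists (fun p => a g (H p)); split => //=; first cont_tac.
- by move=> p; rewrite H0.
- by move=> p; rewrite H1.
- by move=> p t h; rewrite HA.
Qed.

Lemma rhodes_mul_cong f1 f2 f1' f2' :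
  rhodes_class f1 = rhodes_class f1' -> rhodes_class f2 = rhodes_class f2' ->
  rhodes_class (rhodes_map_mul f1 f2) = rhodes_class (rhodes_map_mul f1' f2').
Proof.
move=> /rhodes_class_low[e1 h1] /rhodes_class_low[e2 h2].
apply/rhodes_class_low; split; first by rewrite /= e1 e2.
rewrite !rhodes_low_mul !rhodes_addE; apply: (cg_add_cong cg) => //.
  by move=> w; exact: rhodes_matched.
by rewrite -e1; exact: rhodes_shift_homotopic.
Qed.

Lemma rhodes_inv_cong f f' : rhodes_class f = rhodes_class f' ->
  rhodes_class (rhodes_map_inv f) = rhodes_class (rhodes_map_inv f').
Proof.
move=> /rhodes_class_low[e h]; apply/rhodes_class_low; split; first by rewrite /= e.
rewrite !rhodes_low_inv /rhodes_opp -e.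
exact: rhodes_shift_homotopic (cg_add_opp cg h).
Qed.

Definition rhodes_mul (s t : rhodes) : rhodes :=
  rhodes_class (rhodes_map_mul (repr s) (repr t)).
Definition rhodes_one : rhodes := rhodes_class rhodes_map_one.
Definition rhodes_inv (s : rhodes) : rhodes :=
  rhodes_class (rhodes_map_inv (repr s)).

Lemma rhodes_class_repr s : rhodes_class (repr s) = s.
Proof. exact: reprK. Qed.

Lemma rhodes_mul_class f1 f2 :
  rhodes_mul (rhodes_class f1) (rhodes_class f2) =
  rhodes_class (rhodes_map_mul f1 f2).
Proof. by apply: rhodes_mul_cong; exact: rhodes_class_repr. Qed.

Lemma rhodes_inv_class f :
  rhodes_inv (rhodes_class f) = rhodes_class (rhodes_map_inv f).
Proof. by apply: rhodes_inv_cong; exact: rhodes_class_repr. Qed.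

Lemma rhodes_ind (P : rhodes -> Prop) :
  (forall f, P (rhodes_class f)) -> forall s, P s.
Proof. by move=> h s; rewrite -(rhodes_class_repr s). Qed.

Let const0 (F : W * Gam -> X) : const_on (@set0 W) F. Proof. by []. Qed.

Lemma rhodes_mulA : associative rhodes_mul.
Proof.
elim/rhodes_ind => f1; elim/rhodes_ind => f2; elim/rhodes_ind => f3.
rewrite !rhodes_mul_class; apply/rhodes_class_low; split; first exact: mulgA.
rewrite !rhodes_low_mul !rhodes_addE !rhodes_low_mul !rhodes_addE /=.
rewrite (_ : shift _ (cg_add _ _ _ _) = cg_add g1 nu
   (shift (rhodes_elt f1) (low f2))
   (shift (rhodes_elt f1 * rhodes_elt f2)%g (low f3))); last first.
  apply/funext => p; rewrite /shift /cg_add /on_D /=; case: ifP => //= _.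
  by rewrite actM.
apply: (cg_addA cg); try exact: const0.
- exact: rhodes_low_continuous.
- by apply: rhodes_shift_continuous; exact: rhodes_low_continuous.
- by apply: rhodes_shift_continuous; exact: rhodes_low_continuous.
- by move=> w; exact: rhodes_matched.
- by move=> w; rewrite /shift /= rhodes_low2 rhodes_low1 actM.
Qed.

Lemma rhodes_mul1 : right_id rhodes_one rhodes_mul.
Proof.
elim/rhodes_ind => f; rewrite rhodes_mul_class; apply/rhodes_class_low.
split; first exact: mulg1.
rewrite rhodes_low_mul rhodes_addE rhodes_low_one.
apply: (@cg_add1r _ _ _ _ _ _ cg _ _ _ _ (fun=> a (rhodes_elt f) x0)) => //.
- exact: rhodes_low_continuous.
- by move=> w; rewrite rhodes_low2.
Qed.

Lemma rhodes_1mul : left_id rhodes_one rhodes_mul.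
Proof.
elim/rhodes_ind => f; rewrite rhodes_mul_class; apply/rhodes_class_low.
split; first exact: mul1g.
rewrite rhodes_low_mul rhodes_addE rhodes_low_one /=.
rewrite (_ : shift _ _ = low f); last first.
  by apply/funext => p; rewrite /shift /= act1.
apply: (@cg_add1l _ _ _ _ _ _ cg _ _ _ _ (fun=> x0)) => //.
- exact: rhodes_low_continuous.
- by move=> w; rewrite rhodes_low1.
Qed.

Lemma rhodes_mulV : right_inverse rhodes_one rhodes_inv rhodes_mul.
Proof.
elim/rhodes_ind => f; rewrite rhodes_inv_class rhodes_mul_class.
apply/rhodes_class_low; split; first exact: mulgV.
rewrite rhodes_low_mul rhodes_addE rhodes_low_inv rhodes_low_one.
rewrite (_ : shift _ _ = fun p => low f (p.1, eta p.2)); last first.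
  by apply/funext => p; rewrite /shift /rhodes_opp /= -actM mulgV act1.
rewrite [X in homotopic _ _ _ _ X](_ : _ = fun p => low f (p.1, g1)).
  by apply: (cg_addNr cg) => //; exact: rhodes_low_continuous.
by apply/funext => p; rewrite rhodes_low1.
Qed.

Lemma rhodes_Vmul : left_inverse rhodes_one rhodes_inv rhodes_mul.
Proof.
elim/rhodes_ind => f; rewrite rhodes_inv_class rhodes_mul_class.
apply/rhodes_class_low; split; first exact: mulVg.
rewrite rhodes_low_mul rhodes_addE rhodes_low_inv rhodes_low_one /=.
rewrite (_ : cg_add _ _ _ _ = shift (rhodes_elt f)^-1%g
  (cg_add g1 nu (fun p => low f (p.1, eta p.2)) (low f))); last first.
  by apply/funext => p; rewrite /shift /cg_add /on_D /=; case: ifP.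
rewrite [X in homotopic _ _ _ _ X](_ : _ = shift (rhodes_elt f)^-1%g
  (fun p => low f (p.1, g2))).
  apply: rhodes_shift_homotopic.
  by apply: (cg_addNl cg) => //; exact: rhodes_low_continuous.
by apply/funext => p; rewrite /shift /= rhodes_low2 -actM mulVg act1.
Qed.

HB.instance Definition _ := isGroup.Build rhodes rhodes_mulA rhodes_1mul
  rhodes_mul1 rhodes_Vmul rhodes_mulV.

Lemma rhodes_mulE f1 f2 : (rhodes_class f1 * rhodes_class f2)%g =
  rhodes_class (rhodes_map_mul f1 f2).
Proof. exact: rhodes_mul_class. Qed.

Lemma rhodes_oneE : 1%g = rhodes_class rhodes_map_one.
Proof. by []. Qed.

Definition rhodes_proj (s : rhodes) : G := rhodes_elt (repr s).

Lemma rhodes_projE f : rhodes_proj (rhodes_class f) = rhodes_elt f.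
Proof. by have /rhodes_classP[] := rhodes_class_repr (rhodes_class f). Qed.

End rhodes.

Section fox.
Variables (R : realType) (K : cogroup R) (W X : topologicalType) (x0 : X).
Let k0 := @cg_pt R K.
Let nu := @cg_nu R K.
Let eta := @cg_eta R K.
Let cg : cogroup_axioms k0 k0 R nu eta := cgP K.
Local Notation Wp := (add_point W).

(* K /\ (W u {*}) *)
Definition fox_space := smash k0 (None : Wp).
Local Notation piS := (\pi_fox_space).

Definition fox_base : fox_space := piS (k0, None).

Record fox_map := FoxMap {
  fox_fun :> fox_space -> X ;
  fox_continuous : continuous fox_fun ;
  fox_basepoint : fox_fun fox_base = x0 }.

HB.instance Definition _ := gen_eqMixin fox_map.
HB.instance Definition _ := gen_choiceMixin fox_map.

Definition fox_rel (f1 f2 : fox_map) : bool :=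
  `[< homotopic R [set fox_base] setT f1 f2 >].

Lemma fox_rel_refl : reflexive fox_rel.
Proof.
by move=> f; apply/asboolP/homotopic_refl => //; exact: fox_continuous.
Qed.

Lemma fox_rel_sym : symmetric fox_rel.
Proof. by move=> f f'; apply/asboolP/asboolP; exact: homotopic_sym. Qed.

Lemma fox_rel_trans : transitive fox_rel.
Proof.
move=> f' f f'' /asboolP h /asboolP h'; apply/asboolP.
exact: homotopic_trans h h'.
Qed.

Definition fox_equiv := EquivRel fox_rel fox_rel_refl fox_rel_sym fox_rel_trans.

Definition fox := {eq_quot fox_equiv}.

HB.instance Definition _ := Quotient.on fox.
HB.instance Definition _ := Choice.on fox.

Definition fox_class (f : fox_map) : fox := \pi_fox f.

Lemma fox_classP f f' : fox_class f = fox_class f' <->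
  homotopic R [set fox_base] setT f f'.
Proof.
split=> [/eqmodP|h]; first exact: asboolP.
by apply/eqmodP/asboolP.
Qed.

Lemma fox_class_repr s : fox_class (repr s) = s.
Proof. exact: reprK. Qed.

Lemma fox_ind (P : fox -> Prop) : (forall f, P (fox_class f)) -> forall s, P s.
Proof. by move=> h s; rewrite -(fox_class_repr s). Qed.

Lemma fox_spaceP p q : piS p = piS q <->
  p = q \/ (p.1 = k0 \/ p.2 = None) /\ (q.1 = k0 \/ q.2 = None).
Proof. exact: collapseP. Qed.

Lemma fox_baseP p : piS p = fox_base <-> p.1 = k0 \/ p.2 = None.
Proof.
split=> [/fox_spaceP[->|[]]//|h]; first by left.
by apply/fox_spaceP; right; split => //; left.
Qed.

(* Maps out of the smash product as maps out of (W u {*}) x K. *)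
Let low (f : fox_space -> X) (p : Wp * K) : X := f (piS (p.2, p.1)).
Let Z0 : set Wp := [set None].
Let base := cg_add_base k0 k0 Z0.

Lemma fox_low_continuous (f : fox_map) : continuous (low f).
Proof.
have cf := @fox_continuous f; have cpi : continuous (piS : K * Wp -> fox_space).
  exact: pi_continuous.
rewrite /low; apply: (continuous_comp2 _ cf); apply: (continuous_comp2 _ cpi).
by cont_tac.
Qed.

Lemma fox_low1 (f : fox_map) z : low f (z, k0) = x0.
Proof. by rewrite -(fox_basepoint f) /low (fox_baseP _).2//; left. Qed.

Lemma fox_low2 (f : fox_map) x : low f (None, x) = x0.
Proof. by rewrite -(fox_basepoint f) /low (fox_baseP _).2//; right. Qed.

Lemma fox_low_const (f : fox_map) : const_on Z0 (low f).
Proof. by move=> z x y ->; rewrite !fox_low2. Qed.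

Definition fox_lift (F : Wp * K -> X) (q : fox_space) : X :=
  F ((repr q).2, (repr q).1).

Section mk.
Variable F : Wp * K -> X.
Hypothesis cF : continuous F.
Hypothesis F1 : forall z, F (z, k0) = x0.
Hypothesis F2 : forall x, F (None, x) = x0.

Lemma fox_mkE p : fox_lift F (piS p) = F (p.2, p.1).
Proof.
rewrite /fox_lift.
have /fox_spaceP[->//|[]] : piS (repr (piS p)) = piS p by rewrite reprK.
case: (repr _) => x z; case: p => y w /=.
by move=> [->|->] [->|->]; rewrite ?F1 ?F2.
Qed.

Lemma fox_mk_continuous : continuous (fox_lift F).
Proof.
apply/(@quotient_continuous _ fox_space).
rewrite (_ : _ \o _ = fun p => F (p.2, p.1)); first cont_tac.
by apply/funext => p; exact: fox_mkE.
Qed.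

Lemma fox_mk_base : fox_lift F fox_base = x0.
Proof. by rewrite fox_mkE F1. Qed.

Definition fox_mk : fox_map := FoxMap fox_mk_continuous fox_mk_base.

Lemma fox_low_mk : low fox_mk = F.
Proof. by apply/funext => -[z x]; exact: fox_mkE. Qed.

End mk.

Lemma fox_class_low (f f' : fox_map) :
  fox_class f = fox_class f' <-> homotopic R base setT (low f) (low f').
Proof.
rewrite fox_classP; split=> /homotopicP[H [cH H0 H1 _ HA]].
  apply/homotopicP; exists (fun p => H (piS (p.1.2, p.1.1), p.2)); split => //=.
  - have cpi : continuous (piS : K * Wp -> fox_space) by exact: pi_continuous.
    apply: (continuous_comp2 _ cH); apply: continuous_pair; last by cont_tac.
    by apply: (continuous_comp2 _ cpi); cont_tac.
  - by move=> [z x] t h; apply: HA; apply/fox_baseP; case: h; auto.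
have HA' z x t : x = k0 \/ z = None -> H ((z, x), t) = x0.
  move=> h; rewrite HA.
    by case: h => ->; [exact: fox_low1|exact: fox_low2].
  by case: h; [constructor 1|constructor 3].
apply: (@homotopic_quotient R _ X fox_space _ _ f f'
  (fun p => H ((p.1.2, p.1.1), p.2))) => //=.
- cont_tac.
- by move=> [x z] [y w] t /fox_spaceP[[->->]//|[/= h1 h2]]; rewrite !HA'.
- by move=> [x z]; rewrite H0.
- by move=> [x z]; rewrite H1.
- move=> [x z] t /fox_baseP /= h; rewrite HA'//.
  by rewrite (fox_baseP (x, z)).2// fox_basepoint.
Qed.

(* The comultiplication of K /\ (W u {*}) induced by that of K: the value of
   f1 + f2 at x /\ z is f1 (x' /\ z) if nu x = (x', k0) and f2 (x'' /\ z) if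
   nu x = (k0, x''). *)
Definition fox_add (f1 f2 : fox_map) (p : Wp * K) : X :=
  on_D k0 (fun x => f1 (piS (x, p.1))) (fun x => f2 (piS (x, p.1))) (nu p.2).

Lemma fox_addE f1 f2 : fox_add f1 f2 = cg_add k0 nu (low f1) (low f2).
Proof. by []. Qed.

Lemma fox_matched (f1 f2 : fox_map) z : low f1 (z, k0) = low f2 (z, k0).
Proof. by rewrite !fox_low1. Qed.

Lemma fox_add_continuous f1 f2 : continuous (fox_add f1 f2).
Proof.
by rewrite fox_addE; apply: (cg_add_continuous cg);
  [exact: fox_low_continuous|exact: fox_low_continuous|exact: fox_matched].
Qed.

Lemma fox_add1 f1 f2 z : fox_add f1 f2 (z, k0) = x0.
Proof.
by rewrite fox_addE (cg_addE1 cg) ?fox_low1//; exact: fox_matched.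
Qed.

Lemma fox_add2 f1 f2 x : fox_add f1 f2 (None, x) = x0.
Proof. by rewrite fox_addE; apply: cg_add_const => y; exact: fox_low2. Qed.

Definition fox_map_mul (f1 f2 : fox_map) : fox_map :=
  fox_mk (@fox_add_continuous f1 f2) (fox_add1 f1 f2) (fox_add2 f1 f2).

Definition fox_map_one : fox_map :=
  fox_mk (@continuous_cst _ _ x0) (fun=> erefl) (fun=> erefl).

Definition fox_opp (f : fox_map) (p : Wp * K) : X := f (piS (eta p.2, p.1)).

Lemma fox_opp_continuous f : continuous (fox_opp f).
Proof.
have ceta := cg_eta_continuous cg; have cf := @fox_low_continuous f.
rewrite (_ : fox_opp f = fun p => low f (p.1, eta p.2))//; cont_tac.
Qed.

Lemma fox_opp1 f z : fox_opp f (z, k0) = x0.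
Proof. by rewrite /fox_opp /= (cg_eta1 cg); exact: fox_low1. Qed.

Lemma fox_opp2 f x : fox_opp f (None, x) = x0.
Proof. exact: (fox_low2 f). Qed.

Definition fox_map_inv (f : fox_map) : fox_map :=
  fox_mk (@fox_opp_continuous f) (fox_opp1 f) (fox_opp2 f).

Lemma fox_mul_cong f1 f2 f1' f2' :
  fox_class f1 = fox_class f1' -> fox_class f2 = fox_class f2' ->
  fox_class (fox_map_mul f1 f2) = fox_class (fox_map_mul f1' f2').
Proof.
move=> /fox_class_low h1 /fox_class_low h2; apply/fox_class_low.
by rewrite !fox_low_mk !fox_addE; apply: (cg_add_cong cg) => //; exact: fox_matched.
Qed.

Lemma fox_inv_cong f f' : fox_class f = fox_class f' ->
  fox_class (fox_map_inv f) = fox_class (fox_map_inv f').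
Proof.
move=> /fox_class_low h; apply/fox_class_low; rewrite !fox_low_mk.
exact: (cg_add_opp cg h).
Qed.

Definition fox_mul (s t : fox) : fox := fox_class (fox_map_mul (repr s) (repr t)).
Definition fox_one : fox := fox_class fox_map_one.
Definition fox_inv (s : fox) : fox := fox_class (fox_map_inv (repr s)).

Lemma fox_mul_class f1 f2 :
  fox_mul (fox_class f1) (fox_class f2) = fox_class (fox_map_mul f1 f2).
Proof. by apply: fox_mul_cong; exact: fox_class_repr. Qed.

Lemma fox_inv_class f : fox_inv (fox_class f) = fox_class (fox_map_inv f).
Proof. by apply: fox_inv_cong; exact: fox_class_repr. Qed.

Lemma fox_mulA : associative fox_mul.
Proof.
elim/fox_ind => f1; elim/fox_ind => f2; elim/fox_ind => f3.
rewrite !fox_mul_class; apply/fox_class_low.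
rewrite !fox_low_mk !fox_addE !fox_low_mk !fox_addE.
by apply: (cg_addA cg); try exact: fox_low_continuous;
  try exact: fox_low_const; exact: fox_matched.
Qed.

Lemma fox_mul1 : right_id fox_one fox_mul.
Proof.
elim/fox_ind => f; rewrite fox_mul_class; apply/fox_class_low.
rewrite fox_low_mk fox_addE fox_low_mk.
apply: (@cg_add1r _ _ _ _ _ _ cg _ _ _ _ (fun=> x0)).
- exact: fox_low_continuous.
- exact: fox_low_const.
- exact: fox_low1.
Qed.

Lemma fox_1mul : left_id fox_one fox_mul.
Proof.
elim/fox_ind => f; rewrite fox_mul_class; apply/fox_class_low.
rewrite fox_low_mk fox_addE fox_low_mk.
apply: (@cg_add1l _ _ _ _ _ _ cg _ _ _ _ (fun=> x0)).
- exact: fox_low_continuous.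
- exact: fox_low_const.
- exact: fox_low1.
Qed.

Lemma fox_low1_fun (f : fox_map) : (fun p : Wp * K => low f (p.1, k0)) = fun=> x0.
Proof. by apply/funext => p; exact: fox_low1. Qed.

Lemma fox_mulV : right_inverse fox_one fox_inv fox_mul.
Proof.
elim/fox_ind => f; rewrite fox_inv_class fox_mul_class; apply/fox_class_low.
rewrite fox_low_mk fox_addE !fox_low_mk -(fox_low1_fun f).
by apply: (cg_addNr cg); [exact: fox_low_continuous|exact: fox_low_const].
Qed.

Lemma fox_Vmul : left_inverse fox_one fox_inv fox_mul.
Proof.
elim/fox_ind => f; rewrite fox_inv_class fox_mul_class; apply/fox_class_low.
rewrite fox_low_mk fox_addE !fox_low_mk -(fox_low1_fun f).
by apply: (cg_addNl cg); [exact: fox_low_continuous|exact: fox_low_const].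
Qed.

HB.instance Definition _ := isGroup.Build fox fox_mulA fox_1mul fox_mul1
  fox_Vmul fox_mulV.

Lemma fox_mulE f1 f2 :
  (fox_class f1 * fox_class f2)%g = fox_class (fox_map_mul f1 f2).
Proof. exact: fox_mul_class. Qed.

Lemma fox_oneE : 1%g = fox_class fox_map_one.
Proof. by []. Qed.

End fox.

Section fox_to_rhodes.
Variables (R : realType) (G : groupType) (X : topologicalType).
Variables (a : top_action G X) (x0 : X) (Gam : cogroup2 R) (W : topologicalType).
Let g1 := cg2_pt1 Gam.
Let g2 := cg2_pt2 Gam.
Local Notation GW := (GamW Gam W).
Local Notation Gam0W := (fox_space (cogroup0 Gam) W).
Local Notation Fox := (fox (cogroup0 Gam) W x0).
Local Notation Rhodes := (rhodes a x0 Gam W).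

(* The quotient map Gam(W) -> Gam0 /\ (W u {*}), (w, x) |-> x /\ w. *)
Definition GamW_quot (q : GW) : Gam0W :=
  \pi_Gam0W (\pi_(Gam0 Gam) (repr q).2, Some (repr q).1).

Lemma GamW_quot_base (q : GW) : (repr q).2 = g1 \/ (repr q).2 = g2 ->
  GamW_quot q = fox_base _ _.
Proof.
by move=> h; apply/fox_baseP; left; rewrite /=; case: h => ->; rewrite ?pi0_g2.
Qed.

Lemma GamW_quotE w x :
  GamW_quot (\pi_GW (w, x)) = \pi_Gam0W (\pi_(Gam0 Gam) x, Some w).
Proof.
have /GamWP[e|[/= e h]] : \pi_GW (repr (\pi_GW (w, x))) = \pi_GW (w, x).
  by rewrite reprK.
  by rewrite /GamW_quot e.
rewrite GamW_quot_base//; apply/esym/fox_baseP; left => /=.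
by case: h; rewrite e => ->; rewrite ?pi0_g2.
Qed.

Lemma GamW_quot_continuous : continuous GamW_quot.
Proof.
apply/(@quotient_continuous _ GW).
have c0 : continuous (\pi_(Gam0 Gam) : Gam -> Gam0 Gam) by exact: pi0_continuous.
have c1 : continuous (\pi_Gam0W : Gam0 Gam * add_point W -> Gam0W).
  exact: pi_continuous.
have c2 := @Some_continuous W.
rewrite (_ : _ \o _ = fun p => \pi_Gam0W (\pi_(Gam0 Gam) p.2, Some p.1)).
  by apply: (continuous_comp2 _ c1); cont_tac.
by apply/funext => -[w x]; exact: GamW_quotE.
Qed.

Section map.
Variable f : fox_map (cogroup0 Gam) W x0.

Lemma fox_to_rhodes_continuous : continuous (f \o GamW_quot).
Proof.
exact: (continuous_comp2 GamW_quot_continuous (@fox_continuous _ _ _ _ _ f)).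
Qed.

Lemma fox_to_rhodes_base1 q : GamW_base1 q -> (f \o GamW_quot) q = x0.
Proof.
move=> [w _ <-] /=; rewrite GamW_quotE -[RHS](fox_basepoint f); congr (f _).
by apply/fox_baseP; left.
Qed.

Lemma fox_to_rhodes_base2 q : GamW_base2 q -> (f \o GamW_quot) q = a 1%g x0.
Proof.
move=> [w _ <-] /=; rewrite GamW_quotE act1 -[RHS](fox_basepoint f); congr (f _).
by apply/fox_baseP; left; exact: pi0_g2.
Qed.

Definition fox_to_rhodes_map : rhodes_map a x0 Gam W :=
  RhodesMap fox_to_rhodes_continuous fox_to_rhodes_base1 fox_to_rhodes_base2.

End map.

Definition fox_to_rhodes (s : Fox) : Rhodes :=
  rhodes_class (fox_to_rhodes_map (repr s)).

Lemma fox_to_rhodesE f :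
  fox_to_rhodes (fox_class f) = rhodes_class (fox_to_rhodes_map f).
Proof.
have /fox_classP/homotopicP[H [cH H0 H1 _ HA]] := fox_class_repr (fox_class f).
apply/rhodes_classP; split => //; apply/homotopicP.
have cq := GamW_quot_continuous.
exists (fun p => H (GamW_quot p.1, p.2)); split => //=; first cont_tac.
- move=> y t h; apply: HA; case: h => -[w _ <-]; rewrite GamW_quotE.
    by apply/fox_baseP; left.
  by apply/fox_baseP; left; exact: pi0_g2.
Qed.

End fox_to_rhodes.

Definition short_exact (A B C : groupType) (i : A -> B) (p : B -> C) : Prop :=
  [/\ {morph i : x y / (x * y)%g}, {morph p : x y / (x * y)%g},
      i @^-1` [set 1%g] = [set 1%g],
      range i = p @^-1` [set 1%g] & range p = setT].

(* Main.v *)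
(* A homotopy of maps Gam(W) -> X that takes the value x0 at both basepoints
   descends to the smash product because Gam -> Gam0 collapses two closed points:
   it is a perfect map, hence remains a quotient map after taking products.  This
   gives exactness on the left and in the middle.

   Surjectivity of the projection needs a map Gam(W) -> X joining x0 to g x0.
   A path in X provides one once there is a continuous phi : Gam -> [0, 1] with
   phi g1 = 0 and phi g2 = 1.  Such a phi comes from the comultiplication: nu
   cuts Gam into two closed halves, each mapped to Gam again, and iterating this
   reads off the binary digits of phi. *)
Require Import Defs.
From HB Require Import structures.
From mathcomp Require Import all_boot all_order all_algebra.
From mathcomp Require Import all_classical all_reals all_analysis.
From mathcomp Require Import lra.
Import Order.TTheory GRing.Theory Num.Theory numFieldNormedType.Exports.

Set Implicit Arguments.
Unset Strict Implicit.
Unset Printing Implicit Defensive.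

Local Open Scope classical_set_scope.
Local Open Scope quotient_scope.
Local Open Scope ring_scope.

(** * A continuous function separating the two basepoints *)

Section separating_function.
Variables (R : realType) (Gam : topologicalType) (g1 g2 : Gam).
Variables (nu : Gam -> Gam * Gam) (eta : Gam -> Gam).
Hypothesis cg : cogroup_axioms g1 g2 R nu eta.
Implicit Types (phi : Gam -> R) (x y : Gam).

(** Prepends a binary digit: [0] on the half of [Gam] that [nu] sends to the first copy, [1] on the
    other half. *)
Definition halving phi : Gam -> R :=
  on_D g1 (fun y => phi y / 2) (fun y => (1 + phi y) / 2) \o nu.

(* The digit function is the fixed point of halving, but the iterates of halving
   need not be continuous; instead, each application of halving halves the local
   oscillation, so the fixed point has none. *)
Definition osc_le (e : R) phi :=
  forall x, \forall y \near x, `|phi y - phi x| <= e.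

(** Each closed half contains [x] or misses a neighbourhood of it. Where [x] lies in the half, the
    bound passes along a coordinate of [nu], and [halving phi] has slope 1/2 in [phi]; both formulas
    agree where the halves meet. *)
Lemma halving_osc e phi : 0 <= e -> phi g1 = 0 -> phi g2 = 1 ->
  osc_le e phi -> osc_le (e / 2) (halving phi).
Proof.
move=> e0 p1 p2 pe x.
have uv : phi g2 / 2 = (1 + phi g1) / 2 by rewrite p1 p2 addr0.
have cnu := cg_nu_continuous cg.
have c1 : continuous (fun y => (nu y).1).
  exact: continuous_comp2 cnu (@continuous_fst _ _).
have c2 : continuous (fun y => (nu y).2).
  exact: continuous_comp2 cnu (@continuous_snd _ _).
have hA y : (nu y).2 = g1 -> halving phi y = phi (nu y).1 / 2.
  by move=> h; rewrite /halving /= /on_D h eqxx.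
have hB y : (nu y).1 = g2 -> halving phi y = (1 + phi (nu y).2) / 2.
  by move=> h; rewrite /halving /= (@on_DE2 _ g1 g2).
have nA : \forall y \near x, (nu y).2 = g1 ->
    (nu x).2 = g1 /\ `|phi (nu y).1 - phi (nu x).1| <= e.
  have [xA|xA] := pselect ((nu x).2 = g1).
    have h : \forall y \near x, `|phi (nu y).1 - phi (nu x).1| <= e.
      exact: (c1 x _ (pe (nu x).1)).
    by apply: filterS h.
  have : open (~` [set y | (nu y).2 = g1]).
    by apply: closed_openC; exact: closed_fiber (cg_closed1 cg).
  by rewrite openE => /(_ x xA); apply: filterS.
have nB : \forall y \near x, (nu y).1 = g2 ->
    (nu x).1 = g2 /\ `|phi (nu y).2 - phi (nu x).2| <= e.
  have [xB|xB] := pselect ((nu x).1 = g2).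
    have h : \forall y \near x, `|phi (nu y).2 - phi (nu x).2| <= e.
      exact: (c2 x _ (pe (nu x).2)).
    by apply: filterS h.
  have : open (~` [set y | (nu y).1 = g2]).
    by apply: closed_openC; exact: closed_fiber (cg_closed2 cg).
  by rewrite openE => /(_ x xB); apply: filterS.
near=> y; have [yA|yB] := cg_nu_D cg y.
  have [xA h] : (nu x).2 = g1 /\ `|phi (nu y).1 - phi (nu x).1| <= e.
    by apply: (near nA y) => //.
  by rewrite !hA// -mulrBl normrM (ger0_norm (x := 2^-1))// ler_pM2r// invr_gt0.
have [xB h] : (nu x).1 = g2 /\ `|phi (nu y).2 - phi (nu x).2| <= e.
  by apply: (near nB y) => //.
rewrite !hB// -mulrBl normrM (ger0_norm (x := 2^-1))// ler_pM2r ?invr_gt0//.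
by rewrite opprD addrACA subrr add0r.
Unshelve. all: by end_near. Qed.

(** The iterates from [0] increase and stay below [1], hence converge pointwise; [halving] reads a
    single value of its argument at each point, so it commutes with the limit. *)
Lemma halving_fixpoint : exists phi,
  (forall x, 0 <= phi x <= 1) /\ halving phi = phi.
Proof.
pose p n := iter n halving (fun=> 0).
have pE n x : p n.+1 x = on_D g1 (fun y => p n y / 2) (fun y => (1 + p n y) / 2) (nu x).
  by [].
have p01 n x : 0 <= p n x <= 1.
  elim: n x => [|n IH] x; first by rewrite /p /= lexx ler01.
  rewrite pE /on_D; case: ifP => _; [have := IH (nu x).1 | have := IH (nu x).2];
    by move=> /andP[? ?]; apply/andP; split; lra.
have pS n x : p n x <= p n.+1 x.
  elim: n x => [|n IH] x; first by have /andP[] := p01 1%N x.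
  rewrite pE (pE n.+1) /on_D; case: ifP => _;
   [have := IH (nu x).1 | have := IH (nu x).2]; lra.
have pc x : cvgn (p ^~ x).
  apply: nondecreasing_is_cvgn.
    by apply/nondecreasing_seqP => n; exact: pS.
  by exists 1 => _ [n _ <-]; have /andP[] := p01 n x.
exists (fun x => limn (p ^~ x)); split.
  move=> x; apply/andP; split.
    by apply: limr_ge => //; apply: nearW => n; have /andP[] := p01 n x.
  by apply: limr_le => //; apply: nearW => n; have /andP[] := p01 n x.
apply/funext => x; apply/esym.
have h : (fun n => p n.+1 x) @ \oo --> limn (p ^~ x) by rewrite (cvg_shiftS (p ^~ x)).
apply: (cvg_unique _ h) => //.
rewrite (_ : (fun n => _) = fun n =>
  on_D g1 (fun y => p n y / 2) (fun y => (1 + p n y) / 2) (nu x))//.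
rewrite /halving /= /on_D; case: ifP => _; apply: cvgM; try exact: cvg_cst.
  exact: pc.
by apply: cvgD; [exact: cvg_cst | exact: pc].
Qed.

Lemma separating_function (g12 : g1 <> g2) : exists phi,
  [/\ continuous phi, forall x, 0 <= phi x <= 1, phi g1 = 0 & phi g2 = 1].
Proof.
have [phi [p01 pE]] := halving_fixpoint.
have p1 : phi g1 = 0.
  have : phi g1 = phi g1 / 2.
    by rewrite -{1}pE /halving /= (cg_nu1 cg) /on_D /= eqxx.
  lra.
have p2 : phi g2 = 1.
  have := congr1 (@^~ g2) pE; rewrite /halving /= (cg_nu2 cg) /on_D /=.
  (* As [g2] differs from [g1], the second clause of [on_D] applies and gives
     [phi g2 = (1 + phi g2) / 2]. *)
  case: eqP => [e|_]; first by case: (g12).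
  lra.
exists phi; split => //.
(* Values in [[0, 1]] oscillate by at most [1]; every use of [halving phi = phi] halves the
   bound. *)
have osc n : osc_le (2 ^- n) phi.
  elim: n => [|n IH].
    rewrite expr0 invr1 => x; apply: nearW => y.
    have /andP[? ?] := p01 x; have /andP[? ?] := p01 y.
    by rewrite ler_norml; apply/andP; split; lra.
  by rewrite -pE exprS invfM mulrC; apply: halving_osc.
move=> x; apply/cvgrPdist_le => e e0.
have [n ne] : exists n, 2 ^- n <= e.
  have [n ne] := filter_ex (near_infty_natSinv_expn_lt (PosNum e0)).
  by exists n; rewrite -div1r; exact: ltW.
by apply: filterS (osc n x) => y h; rewrite distrC (le_trans h).
Qed.

End separating_function.

(** * Continuity on products with a disjoint basepoint or a collapse *)

(** [None] is an open point and [Some] an open embedding, so continuity is local on the two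
    pieces. *)
Lemma continuous_add_point (W T X : topologicalType) (F : add_point W * T -> X) :
  continuous (fun t => F (None, t)) -> continuous (fun p => F (Some p.1, p.2)) ->
  continuous F.
Proof.
move=> cN cS [[w|] t] O nO.
  have [[U V] [/= nU nV] UV] := cS (w, t) _ nO.
  exists (Some @` U, V).
    split => //=; move: nU; rewrite nbhsE => -[U' [oU' U'w] UU'].
    rewrite nbhsE; exists (Some @` U').
      split; last by exists w.
      rewrite /open /= /add_point_open (_ : _ @^-1` _ = U')//.
      apply/seteqP; split => [v /= [v' h [<-]]//|v h].
      by exists v.
    by apply: image_subset.
  by move=> [_ s] [/= [v Uv <-] Vs]; exact: (UV (v, s)).
have nV := cN t _ nO.
exists ([set None], [set s | O (F (None, s))]).
  split => //=; rewrite nbhsE; exists [set None] => //; split => //.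
  rewrite /open /= /add_point_open (_ : _ @^-1` _ = set0); first exact: open0.
  by apply/seteqP; split.
by move=> [_ s] [/= -> h].
Qed.

(* Collapsing two closed points is a perfect map, so its product with any
   identity map is again a quotient map. *)
Lemma continuous_collapse2 (Z Y X : topologicalType) (a b : Y)
    (F : Z * collapse [set a; b] -> X) :
  closed [set a] -> closed [set b] ->
  continuous (fun p : Z * Y => F (p.1, \pi_(collapse [set a; b]) p.2)) ->
  continuous F.
Proof.
move=> ca cb cF [z q] O nO.
pose pi := \pi_(collapse [set a; b]) : Y -> collapse [set a; b].
have pi_ab : pi b = pi a by apply/collapseP; right; split; [right|left].
have nq (V : set (collapse [set a; b])) r : open (pi @^-1` V) -> V r -> nbhs r V.
  by move=> oV Vr; rewrite nbhsE; exists V.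
have loc x : nbhs (F (z, pi x)) O -> exists U V,
    [/\ nbhs z U, open V, V x & forall u v, U u -> V v -> O (F (u, pi v))].
  move=> h; have [[U V] [/= nU nV] UV] := cF (z, x) _ h.
  move: nV; rewrite nbhsE => -[V' [oV' V'x] VV'].
  exists U, V'; split => // u v Uu Vv; exact: (UV (u, v) (conj Uu (VV' _ Vv))).
have qE : q = pi (repr q) by rewrite /pi reprK.
have [qab|qab] := pselect ([set a; b] (repr q)).
  have qa : q = pi a by rewrite qE; case: qab => ->.
  rewrite qa in nO *.
  have [U1 [V1 [nU1 oV1 V1a h1]]] := loc a nO.
  have [U2 [V2 [nU2 oV2 V2b h2]]] : exists U V,
    [/\ nbhs z U, open V, V b & forall u v, U u -> V v -> O (F (u, pi v))].
    by apply: loc; rewrite pi_ab.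
  (* Open sets around [a] and around [b] have a saturated union, whose image is open. *)
  exists (U1 `&` U2, pi @` (V1 `|` V2)).
    split => /=; first exact: filterI.
    apply: nq; last by exists a => //; left.
    rewrite (_ : _ @^-1` _ = V1 `|` V2); first exact: openU.
    apply/seteqP; split => [x [y yV /collapseP[<-//|[_ []->]]]|x xV].
    - by left.
    - by right.
    - by exists x.
  by move=> [u _] [/= [u1 u2] [v [v1|v2] <-]]; [exact: h1|exact: h2].
rewrite qE in nO *.
have [U [V [nU oV Vx h]]] := loc _ nO.
(* Removing the closed set [{a, b}] makes [V] saturated. *)
exists (U, pi @` (V `&` ~` [set a; b])).
  split => //=; apply: nq; last by exists (repr q).
  rewrite (_ : _ @^-1` _ = V `&` ~` [set a; b]).
    by apply: openI => //; apply: closed_openC; exact: closedU.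
  apply/seteqP; split => [x [y [yV yab] /collapseP[<-//|[]//]]|x xV].
  by exists x.
by move=> [u _] [/= Uu [v [Vv _] <-]]; exact: h.
Qed.

(** * Descent of homotopies along the collapse of the basepoints *)

Section descend.
Variables (R : realType) (Gam : cogroup2 R) (W T X : topologicalType) (x0 : X).
Let g1 := cg2_pt1 Gam.
Let g2 := cg2_pt2 Gam.
Variable H : (W * Gam) * T -> X.
Hypothesis cH : continuous H.
Hypothesis H1 : forall w t, H ((w, g1), t) = x0.
Hypothesis H2 : forall w t, H ((w, g2), t) = x0.

(** [T] is the time of a homotopy. The chosen preimage [repr] does not matter since [H] equals [x0]
    over both basepoints. *)
Definition descend (p : (add_point W * Gam0 Gam) * T) : X :=
  if p.1.1 is Some w then H ((w, repr p.1.2), p.2) else x0.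

Lemma descendE w x t : descend ((Some w, \pi_(Gam0 Gam) x), t) = H ((w, x), t).
Proof.
rewrite /descend /=.
have /Gam0P[->//|[]] : \pi_(Gam0 Gam) (repr (\pi_(Gam0 Gam) x)) = \pi_(Gam0 Gam) x.
  by rewrite reprK.
by move=> [->|->] [->|->]; rewrite ?H1 ?H2.
Qed.

Lemma descend_base z t : descend ((z, Gam0_pt Gam), t) = x0.
Proof. by case: z => // w; rewrite /Gam0_pt descendE H1. Qed.

(** Permuting factors puts [Gam0] last, for the collapse, then [add_point W] first, for the disjoint
    basepoint. *)
Lemma descend_continuous : continuous descend.
Proof.
have cg := cg2P Gam.
pose F (p : (add_point W * T) * Gam0 Gam) := descend ((p.1.1, p.2), p.1.2).
suff cF : continuous F.
  apply: (@continuous_comp2 _ _ _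
    (fun p : (add_point W * Gam0 Gam) * T => ((p.1.1, p.2), p.1.2)) F _ cF).
  apply: continuous_pair; [apply: continuous_pair|].
  - exact: (continuous_comp2 (@continuous_fst _ _) (@continuous_fst _ _)).
  - exact: continuous_snd.
  - exact: (continuous_comp2 (@continuous_fst _ _) (@continuous_snd _ _)).
apply: (continuous_collapse2 (cg_closed1 cg) (cg_closed2 cg)).
pose E (p : add_point W * (T * Gam)) :=
  descend ((p.1, \pi_(Gam0 Gam) p.2.2), p.2.1).
suff cE : continuous E.
  apply: (@continuous_comp2 _ _ _
    (fun p : (add_point W * T) * Gam => (p.1.1, (p.1.2, p.2))) E _ cE).
  apply: continuous_pair; [|apply: continuous_pair].
  - exact: (continuous_comp2 (@continuous_fst _ _) (@continuous_fst _ _)).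
  - exact: (continuous_comp2 (@continuous_fst _ _) (@continuous_snd _ _)).
  - exact: continuous_snd.
apply: continuous_add_point; first exact: continuous_cst.
rewrite (_ : (fun p => _) = fun p : W * (T * Gam) => H ((p.1, p.2.2), p.2.1)).
  apply: (continuous_comp2 _ cH); apply: continuous_pair.
    apply: continuous_pair; first exact: continuous_fst.
    exact: (continuous_comp2 (@continuous_snd _ _) (@continuous_snd _ _)).
  exact: (continuous_comp2 (@continuous_snd _ _) (@continuous_fst _ _)).
by apply/funext => p; rewrite /E /= descendE.
Qed.

End descend.

(** * Exactness at each term *)

Section exactness.
Variables (R : realType) (G : groupType) (X : topologicalType).
Variables (a : top_action G X) (x0 : X) (Gam : cogroup2 R) (W : topologicalType).
Local Notation GW := (GamW Gam W).
Local Notation g1 := (cg2_pt1 Gam).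
Local Notation g2 := (cg2_pt2 Gam).
Local Notation i := (@fox_to_rhodes R G X a x0 Gam W).
Local Notation proj := (@rhodes_proj R G X a x0 Gam W).

Lemma rhodes_class_ext (f f' : rhodes_map a x0 Gam W) :
  rhodes_elt f = rhodes_elt f' -> (forall p, f (\pi_GW p) = f' (\pi_GW p)) ->
  rhodes_class f = rhodes_class f'.
Proof.
move=> e h; apply/rhodes_classP; split => //.
rewrite (_ : rhodes_fun f' = f).
  by apply: homotopic_refl => //; exact: rhodes_continuous.
by apply/funext => q; rewrite -[q]reprK h.
Qed.

Lemma rhodes_projM : {morph proj : s t / (s * t)%g}.
Proof.
elim/rhodes_ind => f1; elim/rhodes_ind => f2.
by rewrite rhodes_mulE !rhodes_projE.
Qed.

(** The twist is by the element [1], and [Gam0_nu] is induced by [nu], so the two representatives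
    coincide on the nose. *)
Lemma fox_to_rhodesM : {morph i : s t / (s * t)%g}.
Proof.
elim/fox_ind => f1; elim/fox_ind => f2.
rewrite fox_mulE !fox_to_rhodesE rhodes_mulE.
apply: rhodes_class_ext => [|[w x]]; first by rewrite /= mulg1.
rewrite [RHS](congr1 (@^~ (w, x)) (rhodes_low_mul _ _)).
rewrite /= GamW_quotE (@fox_mkE _ _ _ _ x0); [|exact: fox_add1|exact: fox_add2].
rewrite /fox_add /rhodes_add /=.
apply: (Gam0_on_D (k := id)).
- rewrite act1 !GamW_quotE.
  have b (f : fox_map (cogroup0 Gam) W x0) y : \pi_(Gam0 Gam) y = Gam0_pt Gam ->
      f (\pi_(fox_space (cogroup0 Gam) W) (\pi_(Gam0 Gam) y, Some w)) = x0.
    by move=> h; rewrite -[RHS](fox_basepoint f); congr (f _);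
      apply/fox_baseP; left.
  by rewrite !b// pi0_g2.
- by move=> y; rewrite GamW_quotE.
- by move=> y; rewrite act1 GamW_quotE.
Qed.

(** A null-homotopy of the pulled-back map is fixed over the basepoints, so it stays at [x0] there
    and descends to a null-homotopy of [f]. *)
Lemma fox_to_rhodes_ker s : i s = 1%g -> s = 1%g.
Proof.
elim/fox_ind: s => f; rewrite fox_to_rhodesE rhodes_oneE fox_oneE.
move=> /rhodes_class_low[_ /homotopicP[H [cH H0 H1 _ HA]]].
rewrite rhodes_low_one in H1.
have fw w : f (GamW_quot (\pi_GW (w, g1))) = x0.
  exact: (rhodes_low1 (fox_to_rhodes_map a f) w).
have fw2 w : f (GamW_quot (\pi_GW (w, g2))) = x0.
  by have := (rhodes_low2 (fox_to_rhodes_map a f) w); rewrite /= act1.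
have e1 w t : H ((w, g1), t) = x0 by rewrite HA /= ?fw//; constructor 1.
have e2 w t : H ((w, g2), t) = x0 by rewrite HA /= ?fw2//; constructor 2.
apply/fox_class_low/homotopicP; exists (descend x0 H).
have fE z q : descend x0 H ((z, q), 0) = f (\pi_(fox_space (cogroup0 Gam) W) (q, z)).
  rewrite -[q]reprK; case: z => [w|].
    by rewrite descendE// H0 /= GamW_quotE.
  rewrite /descend /= -[LHS](fox_basepoint f); congr (f _).
  by apply/esym/fox_baseP; right.
split => //.
- exact: descend_continuous.
- by move=> [z q]; rewrite fE.
- move=> [z q]; rewrite [RHS](@fox_mkE _ _ _ _ x0 (fun=> x0))// -[q]reprK; case: z => [w|//].
  by rewrite descendE// H1.
- move=> [z q] t h; rewrite /= -fE.
  have {h} [->|->//] : q = Gam0_pt Gam \/ z = None.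
    by case: h => /= h; [left|left|right].
  by rewrite !descend_base.
Qed.

(** When the group element is [1] both basepoints go to [x0], so the representative itself factors
    through the smash product. *)
Lemma fox_to_rhodes_img s : proj s = 1%g -> range i s.
Proof.
elim/rhodes_ind: s => f; rewrite rhodes_projE => f1.
(* A stationary homotopy, so that [descend] applies; [F] below is its value at time [0]. *)
pose H (p : (W * Gam) * R) := f (\pi_GW p.1).
have cH : continuous H.
  exact: continuous_comp2 (@continuous_fst _ _)
    (@rhodes_low_continuous _ _ _ _ _ _ _ f).
have e1 w t : H ((w, g1), t) = x0 by exact: (rhodes_low1 f w).
have e2 w t : H ((w, g2), t) = x0.
  by have := rhodes_low2 f w; rewrite f1 act1.
pose F p := descend x0 H (p, 0).
have cF : continuous F.
  apply: (continuous_comp2 _ (descend_continuous cH e1 e2)).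
  apply: continuous_pair; [exact: continuous_idfun|exact: continuous_cst].
have Fb z : F (z, Gam0_pt Gam) = x0 by exact: descend_base.
have FN q : F (None, q) = x0 by [].
exists (fox_class (@fox_mk R (cogroup0 Gam) W X x0 F cF Fb FN)) => //.
rewrite fox_to_rhodesE; apply: rhodes_class_ext => [|[w x]]; first by rewrite f1.
by rewrite /= GamW_quotE (@fox_mkE R (cogroup0 Gam) W X x0 F Fb FN) /F /= descendE.
Qed.

(** A path from [x0] to [g x0], run along the separating function and constant in [W], has the
    required values at the basepoints. *)
Lemma rhodes_proj_surj (X_path : path_connected_space R X) g : range proj g.
Proof.
have [phi [cphi p01 p1 p2]] := separating_function (cg2P Gam) (@cg2_neq R Gam).
have [c [cc c0 c1]] := X_path x0 (a g x0).
pose F (p : W * Gam) := c (phi p.2).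
have cF : continuous F.
  (* The path [c] is only known to be continuous on the unit interval, which contains all values of
     [phi]. *)
  apply: (continuous_within_comp (f := phi \o snd) _ _ cc).
    exact: continuous_comp2 (@continuous_snd _ _) cphi.
  by move=> p; rewrite /= in_itv /=.
have F1 w : F (w, g1) = x0 by rewrite /F /= p1.
have F2 w : F (w, g2) = a g x0 by rewrite /F /= p2.
by exists (rhodes_class (rhodes_mk cF F1 F2)) => //; rewrite rhodes_projE.
Qed.

End exactness.

Theorem theorem2p2 (R : realType) (G : groupType) (X : topologicalType)
    (a : top_action G X) (x0 : X)
    (X_cg : compactly_generated_hausdorff X) (X_path : path_connected_space R X)
    (W : topologicalType) (Gam : cogroup2 R) :
  short_exact (@fox_to_rhodes R G X a x0 Gam W) (@rhodes_proj R G X a x0 Gam W).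
Proof.
have iM := @fox_to_rhodesM R G X a x0 Gam W.
have i1 : fox_to_rhodes a 1%g = 1%g :> rhodes a x0 Gam W.
  by apply: (mulgI (fox_to_rhodes a 1%g)); rewrite -iM !mulg1.
split => //.
- exact: rhodes_projM.
- by apply/seteqP; split => [s|_ ->//]; exact: fox_to_rhodes_ker.
- apply/seteqP; split => [_ [s _ <-]|s].
    by rewrite /= -(fox_class_repr s) fox_to_rhodesE rhodes_projE.
  exact: fox_to_rhodes_img.
- by apply/seteqP; split => // g _; exact: rhodes_proj_surj.
Qed.
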